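(* For any $\epsilon<1$ and any $n\geq(\frac{1}{\epsilon})^{\Theta(1/\epsilon)}$, there is an $n$-vertex edge-weighted graph $G$ that admits a general sparse spanner oracle of stretch $1+\epsilon$ with weak sparsity $O(1)$, such that every $(1+\epsilon)$-spanner of $G$ has lightness $\Omega(\frac{1}{\epsilon^2})$.
   Context: For an edge-weighted graph $G=(V,E,w)$ and $t>1$, a general sparse spanner oracle (GSSO) $\mathcal{O}_{G,t}$ is an algorithm that, given a subset $T\subseteq V$ and a distance parameter $L>0$, outputs in polynomial time a subgraph $\mathcal{O}_{G,t}(T,L)$ of $G$ such that $d_{\mathcal{O}_{G,t}(T,L)}(x,y)\leq t\cdot d_G(x,y)$ for every pair $x\neq y$ in $T$ with $L\leq d_G(x,y)<2L$. Its weak sparsity is $\sup_{T\subseteq V,L>0}\frac{w(\mathcal{O}_{G,t}(T,L))}{|T|L}$. A $(1+\epsilon)$-spanner of $G$ is a spanning subgraph $H$ with $d_H(u,v)\leq(1+\epsilon)d_G(u,v)$ for all $u,v$; its lightness is $w(H)/w(\mathrm{MST}(G))$. *)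

(* Defs.v *)
From HB Require Import structures.
From mathcomp Require Import all_boot all_order all_algebra.
From mathcomp Require Import all_classical all_reals all_analysis.

Set Implicit Arguments.
Unset Strict Implicit.
Unset Printing Implicit Defensive.

Import Order.TTheory GRing.Theory Num.Theory.

Local Open Scope ring_scope.

(* An edge is the two-element set of its endpoints; a subgraph of [G] is
   given by a set of edges of [G] and keeps all the vertices.  [wt G e] is
   meaningful only when [e \in edges G]. *)
Record wgraph (R : realType) (n : nat) := WGraph {
  edges : {set {set 'I_n}};
  wt : {set 'I_n} -> R;
  edges_card2 : forall e, e \in edges -> #|e| = 2%N;
  wt_gt0 : forall e, e \in edges -> 0 < wt e }.

Definition adj (n : nat) (F : {set {set 'I_n}}) : rel 'I_n :=
  fun x y => [set x; y]%SET \in F.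

Definition weight (R : realType) (n : nat) (G : wgraph R n)
    (F : {set {set 'I_n}}) : R :=
  \sum_(e in F) wt G e.

Definition walk_length (R : realType) (n : nat) (G : wgraph R n)
    (x : 'I_n) (p : seq 'I_n) : R :=
  \sum_(e <- pairmap (fun a b => [set a; b]%SET) x p) wt G e.

(* The distance is +oo when no walk in F joins x and y. *)
Definition dist (R : realType) (n : nat) (G : wgraph R n)
    (F : {set {set 'I_n}}) (x y : 'I_n) : \bar R :=
  ereal_inf [set z | exists p : seq 'I_n,
    [/\ path (adj F) x p, last x p = y & z = (walk_length G x p)%:E]]%classic.

Definition dist_graph (R : realType) (n : nat) (G : wgraph R n) :=
  dist G (edges G).

Definition connected_graph (n : nat) (F : {set {set 'I_n}}) : Prop :=
  forall x y : 'I_n, connect (adj F) x y.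

Definition acyclic_graph (n : nat) (F : {set {set 'I_n}}) : Prop :=
  forall c : seq 'I_n, (2 < size c)%N -> ~ ucycle (adj F) c.

Definition spanning_tree (R : realType) (n : nat) (G : wgraph R n)
    (F : {set {set 'I_n}}) : Prop :=
  [/\ F \subset edges G, connected_graph F & acyclic_graph F].

(* For a connected graph the infimum ranges over a finite nonempty set, hence
   it is the weight of a minimum spanning tree. *)
Definition mst_weight (R : realType) (n : nat) (G : wgraph R n) : R :=
  inf [set z | exists2 F, spanning_tree G F & z = weight G F]%classic.

Definition spanner (R : realType) (n : nat) (G : wgraph R n) (t : R)
    (H : {set {set 'I_n}}) : Prop :=
  H \subset edges G /\
  forall x y : 'I_n, (dist G H x y <= t%:E * dist_graph G x y)%E.

Definition lightness (R : realType) (n : nat) (G : wgraph R n)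
    (H : {set {set 'I_n}}) : R :=
  weight G H / mst_weight G.

(* Algorithms are programs for a real RAM.  Memory consists of countably many
   two-dimensional arrays of natural numbers and of real numbers, with
   indirect addressing.  Reals can be added, subtracted, multiplied, divided
   and compared, but not rounded; natural numbers can be added, subtracted
   and compared, but not multiplied in one step. *)
Inductive nexp :=
  | NConst of nat
  | NCell of nat & nexp & nexp
  | NAdd of nexp & nexp
  | NSub of nexp & nexp.

Inductive rexp :=
  | RConst of nat
  | RCell of nat & nexp & nexp
  | RAdd of rexp & rexp
  | RSub of rexp & rexp
  | RMul of rexp & rexp
  | RDiv of rexp & rexp.

Inductive bexp :=
  | BLeN of nexp & nexp
  | BLeR of rexp & rexp
  | BNot of bexp
  | BAnd of bexp & bexp.

Inductive cmd :=
  | Skip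
  | NAssign of nat & nexp & nexp & nexp
  | RAssign of nat & nexp & nexp & rexp
  | Seq of cmd & cmd
  | If of bexp & cmd & cmd
  | While of bexp & cmd.

Record state (R : realType) := State {
  nmem : nat -> nat -> nat -> nat;
  rmem : nat -> nat -> nat -> R }.

Definition upd (A : Type) (m : nat -> nat -> nat -> A) (a i j : nat) (v : A) :
    nat -> nat -> nat -> A :=
  fun a' i' j' => if [&& a' == a, i' == i & j' == j] then v else m a' i' j'.

Fixpoint neval (R : realType) (s : state R) (e : nexp) : nat :=
  match e with
  | NConst k => k
  | NCell a i j => nmem s a (neval s i) (neval s j)
  | NAdd e1 e2 => neval s e1 + neval s e2
  | NSub e1 e2 => neval s e1 - neval s e2
  end%N.

Fixpoint reval (R : realType) (s : state R) (e : rexp) : R :=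
  match e with
  | RConst k => k%:R
  | RCell a i j => rmem s a (neval s i) (neval s j)
  | RAdd e1 e2 => reval s e1 + reval s e2
  | RSub e1 e2 => reval s e1 - reval s e2
  | RMul e1 e2 => reval s e1 * reval s e2
  | RDiv e1 e2 => reval s e1 / reval s e2
  end.

Fixpoint beval (R : realType) (s : state R) (b : bexp) : bool :=
  match b with
  | BLeN e1 e2 => (neval s e1 <= neval s e2)%N
  | BLeR e1 e2 => reval s e1 <= reval s e2
  | BNot b1 => ~~ beval s b1
  | BAnd b1 b2 => beval s b1 && beval s b2
  end.

(* [exec c s m s'] : started in [s], the program [c] halts in [s'] after [m]
   steps.  Assignments and tests have unit cost: the size of the expressions
   they evaluate is bounded in terms of the program alone. *)
Inductive exec (R : realType) : cmd -> state R -> nat -> state R -> Prop :=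
  | exec_skip s : exec Skip s 1 s
  | exec_nassign a i j e s :
      exec (NAssign a i j e) s 1
        (State (upd (nmem s) a (neval s i) (neval s j) (neval s e)) (rmem s))
  | exec_rassign a i j e s :
      exec (RAssign a i j e) s 1
        (State (nmem s) (upd (rmem s) a (neval s i) (neval s j) (reval s e)))
  | exec_seq c1 c2 s s1 s2 m1 m2 :
      exec c1 s m1 s1 -> exec c2 s1 m2 s2 -> exec (Seq c1 c2) s (m1 + m2) s2
  | exec_if b c1 c2 s s' m :
      exec (if beval s b then c1 else c2) s m s' -> exec (If b c1 c2) s m.+1 s'
  | exec_while_false b c s : ~~ beval s b -> exec (While b c) s 1 s
  | exec_while_true b c s s1 s2 m1 m2 :
      beval s b -> exec c s m1 s1 -> exec (While b c) s1 m2 s2 ->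
      exec (While b c) s (m1 + m2).+1 s2.

Definition nat_edge (n : nat) (i j : nat) : {set 'I_n} :=
  match insub i, insub j with
  | Some u, Some v => [set u; v]%SET
  | _, _ => finset.set0
  end.

(* Input convention: natural array 0 holds n at (0, 0), array 1 the adjacency
   matrix, array 2 the indicator of T at (i, 0); real array 0 holds the
   weight matrix (0 off the edges), array 1 the parameter L at (0, 0), array
   2 the stretch t at (0, 0).  All other cells are 0. *)
Definition input (R : realType) (n : nat) (G : wgraph R n) (t : R)
    (T : {set 'I_n}) (L : R) : state R :=
  State
    (fun a i j => match a, i, j with
      | 0, 0, 0 => n
      | 1, _, _ => nat_edge n i j \in edges G
      | 2, _, 0 => if insub i is Some u then u \in T else false
      | _, _, _ => 0
      end%N)
    (fun a i j => match a, i, j with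
      | 0%N, _, _ => if nat_edge n i j \in edges G
                     then wt G (nat_edge n i j) else 0
      | 1%N, 0%N, 0%N => L
      | 2%N, 0%N, 0%N => t
      | _, _, _ => 0
      end).

(* Output convention: natural array 3 holds, at (i, j), a nonzero number for
   the edges {i, j} of the output. *)
Definition output (R : realType) (n : nat) (s : state R) :
    {set {set 'I_n}} :=
  [set e : {set 'I_n} | [exists i : 'I_n, exists j : 'I_n,
    (e == [set i; j]) && (nmem s 3 i j != 0%N)]]%SET.

Definition runs (R : realType) (n : nat) (A : cmd) (G : wgraph R n) (t : R)
    (T : {set 'I_n}) (L : R) (m : nat) (F : {set {set 'I_n}}) : Prop :=
  exists2 s, exec A (input G t T L) m s & F = output n s.

(* [O] is the input-output function of the oracle, [A] the algorithm that
   computes it, in at most k * n ^ k steps.  Running times are meaningful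
   only for a family of graphs: [A] and [k] are to be fixed before [G]. *)
Definition sparse_spanner_oracle (R : realType) (n : nat) (A : cmd) (k : nat)
    (G : wgraph R n) (t : R)
    (O : {set 'I_n} -> R -> {set {set 'I_n}}) : Prop :=
  forall (T : {set 'I_n}) (L : R), 0 < L ->
  [/\ exists2 m, (m <= k * n ^ k)%N & runs A G t T L m (O T L),
      O T L \subset edges G
    & forall x y : 'I_n, x \in T -> y \in T -> x != y ->
      (L%:E <= dist_graph G x y)%E -> (dist_graph G x y < (2 * L)%:E)%E ->
      (dist G (O T L) x y <= t%:E * dist_graph G x y)%E].

Definition weak_sparsity (R : realType) (n : nat) (G : wgraph R n)
    (O : {set 'I_n} -> R -> {set {set 'I_n}}) : \bar R :=
  ereal_sup [set z | exists (T : {set 'I_n}) (L : R),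
    [/\ (0 < #|T|)%N, 0 < L
      & z = (weight G (O T L) / (#|T|%:R * L))%:E]]%classic.

(* Main.v *)
(* The vertices lie on a line.  With A ~ 1/eps, K = 2A and E = 2(A - 2), the line
   is cut at every level j <= m ~ A/10 into cells of K^j steps.  Besides the unit
   edges there are, in each cell of level i + 1, the A + 1 parallel chords that
   jump over A of its 2A child cells.  The first and the last chord of a cell
   lead from end to end, and their weights are such that the ends of a cell of
   level j are at distance exactly A * E^j, slightly less than A * K^j; since
   m <= A/4 the ratio (E/K)^m stays above 1/2.  A detour avoiding a chord is
   longer by a factor 1 + 1/A, because it either walks over A child cells or
   shifts to a parallel chord at both ends; so a (1 + eps)-spanner contains all
   edges.  Every level weighs about A times the unit path, which is a spanning
   tree, and there are about A levels: the lightness is of order A^2.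

   The oracle returns the union of all shortest paths between pairs of terminals
   in the distance range, computed by Bellman-Ford.  The weights of the inner
   chords of a cell increase with their rank, so an inner chord lies on a shortest
   path only if one of the two terminals is within one child cell of one of its
   ends: shifting to a neighbouring chord would be cheaper otherwise.  The first
   and last chords of a cell lie on a shortest path only if a terminal is inside
   the parent cell, as the parent's own chords are faster.  Each terminal thus
   pays, per level, for a constant number of chords plus the edges within distance
   O(L) or within its parent cell, and these costs form a geometric series. *)

Require Import Defs.
From HB Require Import structures.
From mathcomp Require Import all_boot all_order all_algebra.
From mathcomp Require Import all_classical all_reals all_analysis.
From mathcomp Require Import zify ring lra.

Set Implicit Arguments.
Unset Strict Implicit.
Unset Printing Implicit Defensive.

Import Order.TTheory GRing.Theory Num.Theory.

Local Open Scope ring_scope.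

(** * Shortest walks *)

Section ShortestWalks.
Local Open Scope nat_scope.

Variables (V : finType) (W : V -> V -> nat).

Fixpoint wlen (x : V) (p : seq V) : nat :=
  if p is y :: p' then W x y + wlen y p' else 0.

Lemma wlen_cat x p q : wlen x (p ++ q) = wlen x p + wlen (last x p) q.
Proof. by elim: p x => //= y p IH x; rewrite IH addnA. Qed.

(** Every lower bound on distances comes from such a potential [f]. The factor [s] clears
    denominators, since rates like [A * E ^ j / K ^ j] need not be integers. *)
Lemma walk_potential (e : rel V) (f : V -> nat) (s : nat) x p :
  (forall a b, e a b -> f b <= f a + s * W a b) ->
  path e x p -> f (last x p) <= f x + s * wlen x p.
Proof.
move=> fe; elim: p x => [|y p IH] x /=; first by rewrite muln0 addn0.
case/andP=> /fe exy /IH h; apply: leq_trans h _.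
by rewrite mulnDr addnA leq_add2r.
Qed.

Variable e : rel V.
Hypothesis esym : symmetric e.
Hypothesis Wsym : forall x y, W x y = W y x.
Hypothesis W0 : forall x y, e x y -> 0 < W x y.
Hypothesis econn : forall x y, connect e x y.

Definition has_walk x y k : Prop :=
  exists p, [/\ path e x p, last x p = y & wlen x p = k].

Lemma has_walk_ex x y : exists k, `[< has_walk x y k >].
Proof.
have /connectP[p xp ->] := econn x y.
by exists (wlen x p); apply/asboolP; exists p.
Qed.

(** With natural weights the infimum over walks is a minimum, so shortest walks exist and the
    arithmetic stays in [nat]. *)
Definition sdist x y := ex_minn (has_walk_ex x y).

Lemma sdist_walk x y :
  exists p, [/\ path e x p, last x p = y & wlen x p = sdist x y].
Proof. by rewrite /sdist; case: ex_minnP => k /asboolP. Qed.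

Lemma sdist_min x p : path e x p -> sdist x (last x p) <= wlen x p.
Proof.
rewrite /sdist; case: ex_minnP => k _ h xp.
by apply: h; apply/asboolP; exists p.
Qed.

Lemma sdistxx x : sdist x x = 0.
Proof. by apply/eqP; rewrite -leqn0 (@sdist_min x [::]). Qed.

Lemma sdist_tri y x z : sdist x z <= sdist x y + sdist y z.
Proof.
have [p [xp <- <-]] := sdist_walk x y.
have [q [yq <- <-]] := sdist_walk (last x p) z.
by rewrite -wlen_cat -last_cat sdist_min // cat_path xp.
Qed.

Lemma sdist_edge x y : e x y -> sdist x y <= W x y.
Proof.
by move=> exy; have := @sdist_min x [:: y]; rewrite /= exy addn0; apply.
Qed.

Lemma sdist_sym x y : sdist x y = sdist y x.
Proof.
have le a b : sdist b a <= sdist a b; last by apply/eqP; rewrite eqn_leq !le.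
have [p [xp <- <-]] := sdist_walk a b.
elim: p a xp => [|c p IH] a /=; first by rewrite sdistxx.
case/andP=> eac /IH h; apply: leq_trans (sdist_tri c _ _) _.
by rewrite addnC leq_add // Wsym sdist_edge // esym.
Qed.

Lemma sdist_potential (f : V -> nat) (s : nat) x y :
  (forall a b, e a b -> f b <= f a + s * W a b) ->
  f y <= f x + s * sdist x y.
Proof.
by move=> fe; have [p [xp <- <-]] := sdist_walk x y; apply: walk_potential xp.
Qed.

(** A shortest walk from [x] must leave [S]; its first vertex outside [S] serves as [b] and splits
    the distance. *)
Lemma sdist_exit (S : pred V) x y : S x -> ~~ S y ->
  exists a b, [/\ S a, ~~ S b, e a b & sdist x y = sdist x b + sdist b y].
Proof.
move=> Sx Sy; have [p [xp py pl]] := sdist_walk x y.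
suff [a [b [Sa Sb eab h]]] : exists a b,
    [/\ S a, ~~ S b, e a b & sdist x b + sdist b y <= wlen x p].
  exists a, b; split=> //; apply/eqP; rewrite eqn_leq sdist_tri -pl.
  by rewrite h.
elim: p x Sx xp py {pl} => [|c p IH] x Sx /=; first by move=> _ xy; rewrite -xy Sx in Sy.
case/andP=> exc cp cpy; case: (boolP (S c)) => Sc.
  have [a [b [Sa Sb eab h]]] := IH c Sc cp cpy.
  exists a, b; split=> //; apply: leq_trans (leq_add (leqnn _) h).
  rewrite addnA leq_add2r; apply: leq_trans (sdist_tri c _ _) _.
  by rewrite leq_add2r sdist_edge.
exists x, c; split=> //; apply: leq_add; first exact: sdist_edge.
by rewrite -cpy sdist_min.
Qed.

(* The vertices of a shortest walk have increasing distances from its start,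
   so they are distinct. *)
Lemma shortest_walk_size x p :
  path e x p -> wlen x p = sdist x (last x p) -> size p < #|V|.
Proof.
move=> xp pl; suff h : uniq (x :: p).
  by rewrite -[(size p).+1]/(size (x :: p)) -(card_uniqP h) max_card.
apply: (@map_uniq _ _ (sdist x)); apply: (sorted_uniq ltn_trans ltnn).
rewrite /= path_map.
have {pl} : sdist x x + wlen x p = sdist x (last x p) by rewrite sdistxx.
have : forall z, path e z p -> sdist x z + wlen z p = sdist x (last z p) ->
    path (relpre (sdist x) ltn) z p; last by apply.
elim: p {xp} => [|c p IH] z //= /andP[ezc cp] h.
have h1 : sdist x c <= sdist x z + W z c.
  by apply: leq_trans (sdist_tri z _ _) _; rewrite leq_add2l sdist_edge.
have h2 := leq_trans (sdist_tri c x (last c p)) (leq_add (leqnn _) (sdist_min cp)).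
have h0 := W0 ezc.
have h3 : sdist x c = sdist x z + W z c by lia.
rewrite IH // h3 ?andbT; last by rewrite -addnA.
by rewrite -addn1 leq_add2l.
Qed.

End ShortestWalks.

(** * The graph *)

Section LineGraph.
Local Open Scope nat_scope.

Variables A m N : nat.
Local Notation K := (2 * A).
Local Notation E := (2 * (A - 2)).

(** Here [p] is the left end of a chord of level [i]. The third clause reads off its rank in the
    parent cell of level [i + 1]; the last one asks that this cell be complete. *)
Definition chord i p : bool :=
  [&& i < m, K ^ i %| p, (p %/ K ^ i) %% K <= A
    & (p %/ K ^ i.+1).+1 * K ^ i.+1 <= N].

Definition line_edge p q : bool :=
  (q == p.+1) || [exists i : 'I_m, chord i p && (q == p + A * K ^ i)].

(* The term [%% A] breaks the ties between parallel chords, and vanishes for the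
   first and the last chord of a cell, whose ranks are 0 and [A]. *)
Definition line_wt p q : nat :=
  if q == p.+1 then A
  else let l := trunc_log K (q - p) in
    E ^ l * (A * (A - 2) + (p %/ K ^ l) %% A).

Hypothesis A_ge4 : 4 <= A.

Lemma K_gt1 : 1 < K. Proof. lia. Qed.
Lemma expK_gt0 i : 0 < K ^ i. Proof. by rewrite expn_gt0; lia. Qed.
Lemma expE_gt0 i : 0 < E ^ i. Proof. by rewrite expn_gt0; lia. Qed.
Lemma expE_leK i : E ^ i <= K ^ i.
Proof. by case: i => // i; rewrite leq_exp2r //; lia. Qed.
Lemma expE_ltK i : 0 < i -> E ^ i < K ^ i.
Proof. by move=> i0; rewrite ltn_exp2r //; lia. Qed.

(** Coordinates used throughout: [j] is the index of the parent cell and [c] the rank of the chord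
    in it. *)
Lemma chordP i p : reflect
  (exists j c, [/\ i < m, p = (j * K + c) * K ^ i, c <= A
     & j.+1 * (K * K ^ i) <= N]) (chord i p).
Proof.
have X0 := expK_gt0 i; apply: (iffP and4P) => [[im /dvdnP[g ->] gA]|].
  rewrite mulnK // in gA *; rewrite expnSr divnMA mulnK // => gN.
  exists (g %/ K), (g %% K); rewrite -divn_eq; split=> //.
  by rewrite [K * K ^ i]mulnC.
move=> [j [c [im -> cA gN]]]; have K0 : 0 < K by lia.
have cK : c < K by lia.
rewrite dvdn_mull // mulnK // modnMDl modn_small // expnSr divnMA mulnK //.
by rewrite divnMDl // divn_small // addn0 [_ * K]mulnC; split.
Qed.

Lemma line_wt_chord i p : line_wt p (p + A * K ^ i)
  = E ^ i * (A * (A - 2) + (p %/ K ^ i) %% A).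
Proof.
have X0 := expK_gt0 i; rewrite /line_wt ifF; last first.
  rewrite -[p.+1]addn1 eqn_add2l; apply/eqP.
  by have := leq_pmulr A X0; lia.
rewrite addKn (_ : trunc_log K (A * K ^ i) = i) //.
(* The length [A * K ^ i] lies between [K ^ i] and [K ^ i.+1], so its logarithm recovers the
   level. *)
apply: trunc_log_eq; first exact: K_gt1.
by rewrite expnS; apply/andP; split; nia.
Qed.

Lemma line_edgeP p q : line_edge p q ->
  q = p.+1 /\ line_wt p q = A \/
  exists i j c, [/\ i < m, p = (j * K + c) * K ^ i, q = p + A * K ^ i,
     c <= A & j.+1 * (K * K ^ i) <= N] /\
     line_wt p q = E ^ i * (A * (A - 2) + c %% A).
Proof.
case/orP=> [/eqP->|/existsP[i /andP[/chordP[j [c [im -> cA gN]]] /eqP->]]].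
  by left; rewrite /line_wt eqxx.
right; exists i, j, c; split=> //; rewrite line_wt_chord mulnK ?expK_gt0 //.
by rewrite [j * K]mulnA modnMDl.
Qed.

Lemma line_edge_chord i p : chord i p -> line_edge p (p + A * K ^ i).
Proof.
move=> h; apply/orP; right; have /and4P[im _ _ _] := h.
by apply/existsP; exists (Ordinal im); rewrite h eqxx.
Qed.

Lemma line_edge_lt p q : line_edge p q -> p < q.
Proof.
case/line_edgeP=> [[-> _] //|[i [j [c [[_ _ -> _ _] _]]]]].
by have := expK_gt0 i; nia.
Qed.

Lemma line_wt_gt0 p q : line_edge p q -> 0 < line_wt p q.
Proof.
case/line_edgeP=> [[_ ->]|[i [j [c [_ ->]]]]]; first lia.
by have := expE_gt0 i; nia.
Qed.

(* The ends of a cell of level [j] will be at distance [A * E ^ j]; lower chords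
   are slower per unit of length. *)
Lemma chord_rate i j c : i < j ->
  A * E ^ j * (A * K ^ i) <= K ^ j * (E ^ i * (A * (A - 2) + c)).
Proof.
move=> ij; have [d ->] : exists d, j = i + d.+1 by exists (j - i.+1); lia.
have h := expE_leK d; rewrite !expnD !expnS.
apply: (@leq_trans (K ^ i * (K * K ^ d) * (E ^ i * (A * (A - 2))))); last first.
  by rewrite !leq_mul2l leq_addr !orbT.
have -> : A * (E ^ i * (E * E ^ d)) * (A * K ^ i) = (A * A * E * E ^ i * K ^ i) * E ^ d by ring.
have -> : K ^ i * (K * K ^ d) * (E ^ i * (A * (A - 2))) = (A * A * E * E ^ i * K ^ i) * K ^ d by ring.
by rewrite leq_mul2l h orbT.
Qed.

(** For [j = i + 1] and [c = 0] both sides agree, as the first and last chords realise the distance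
    between the ends of their cell; strictness starts two levels up, from [E < K]. *)
Lemma chord_rate_lt i j c : i.+1 < j ->
  A * E ^ j * (A * K ^ i) < K ^ j * (E ^ i * (A * (A - 2) + c)).
Proof.
move=> ij; have [d ->] : exists d, j = i + d.+2 by exists (j - i.+2); lia.
have h := @expE_ltK d.+1 isT.
rewrite expnD [E ^ d.+2]expnS expnD [K ^ d.+2]expnS.
apply: (@leq_trans (K ^ i * (K * K ^ d.+1) * (E ^ i * (A * (A - 2))))); last first.
  by rewrite !leq_mul2l leq_addr !orbT.
have -> : A * (E ^ i * (E * E ^ d.+1)) * (A * K ^ i) = (A * A * E * E ^ i * K ^ i) * E ^ d.+1 by ring.
have -> : K ^ i * (K * K ^ d.+1) * (E ^ i * (A * (A - 2))) = (A * A * E * E ^ i * K ^ i) * K ^ d.+1 by ring.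
rewrite ltn_mul2l h andbT !muln_gt0 expE_gt0 expK_gt0; lia.
Qed.

(** Since [A - 2] is at least 2, a single chord of level [j] or higher costs at least as much as
    crossing a whole cell of level [j]. *)
Lemma chord_heavy i j c : j <= i -> A * E ^ j <= E ^ i * (A * (A - 2) + c).
Proof.
move=> ij; have -> : i = j + (i - j) by lia.
rewrite expnD; have := expE_gt0 (i - j); set x := E ^ _; set y := E ^ _.
move=> y0; rewrite -mulnA mulnC leq_mul2l; apply/orP; right.
have : A * 2 <= A * (A - 2) by rewrite leq_mul2l; lia.
nia.
Qed.

(** Cells are laminar: a chord of level below [j] stays in its parent cell, of level at most [j],
    while a chord of level [j] or higher has both ends at multiples of [K ^ j], hence none strictly
    inside. *)
Lemma cell_nest a j p q : line_edge p q ->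
  a * K ^ j < p < a.+1 * K ^ j \/ a * K ^ j < q < a.+1 * K ^ j ->
  a * K ^ j <= p /\ q <= a.+1 * K ^ j.
Proof.
move=> /line_edgeP[[-> _]|[i [g [c [[_ pE qE cA _] _]]]]]; first lia.
have X0 := expK_gt0 i.
have [ij|ji] := ltnP i j.
  have -> : K ^ j = K ^ (j - i.+1) * (K * K ^ i).
    by rewrite -expnS -expnD; congr (_ ^ _); lia.
  rewrite !mulnA; set u := a * _; set v := a.+1 * _.
  set X := K ^ i in X0 pE qE *.
  have p1 : g * K * X <= p by nia.
  have p2 : p < g.+1 * K * X by rewrite pE ltn_pmul2r //; nia.
  have q1 : g * K * X < q by nia.
  have q2 : q <= g.+1 * K * X.
    by rewrite qE pE -mulnDl leq_pmul2r //; nia.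
  have K0 : 0 < K by lia.
  have mono x y : (x * 2 * A * X <= y * 2 * A * X) = (x <= y).
    by rewrite !leq_pmul2r //; lia.
  have smono x y : (x * 2 * A * X < y * 2 * A * X) = (x < y).
    by rewrite !ltn_pmul2r //; lia.
  rewrite !mulnA in p1 p2 q1 q2.
  case=> /andP[h1 h2].
  - have := leq_trans h1 (ltnW p2); have := leq_ltn_trans p1 h2.
    rewrite !smono -mono => h3; split; first exact: ltnW.
    exact: leq_trans q2 h3.
  - have := leq_trans h1 q2; have := ltn_trans q1 h2.
    rewrite !smono ltnS -mono -[u <= g]mono => h3 h4.
    by split; [exact: leq_trans h4 p1|exact: ltnW].
have iE : K ^ i = K ^ (i - j) * K ^ j by rewrite -expnD; congr (_ ^ _); lia.
have no b : ~ (a * K ^ j < b * K ^ j < a.+1 * K ^ j).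
  by rewrite !ltn_pmul2r ?expK_gt0 //; lia.
have -> : p = ((g * K + c) * K ^ (i - j)) * K ^ j by rewrite -mulnA -iE.
have -> : q = ((g * K + c + A) * K ^ (i - j)) * K ^ j.
  by rewrite -mulnA -iE qE pE -mulnDl.
by case=> /no.
Qed.

(** Bernoulli's inequality: [(1 - 2 / A) ^ i >= 1 - 2 * i / A], and this is at least 1/2 because
    [4 * i <= A]. *)
Lemma expK_le2E i : 4 * m <= A -> i <= m -> K ^ i <= 2 * E ^ i.
Proof.
move=> m_le im; have h : (A - 2 * i) * K ^ i <= A * E ^ i.
  elim: i im => [|i IH] im; first by rewrite !expn0; lia.
  have := IH (ltnW im); rewrite !expnS => h.
  apply: (@leq_trans (E * ((A - 2 * i) * K ^ i))); last first.
    by rewrite [A * _]mulnCA leq_mul2l h orbT.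
  rewrite !mulnA leq_mul2r; apply/orP; right.
  have [b bE] : exists b, A = b + 4 * i + 4 by exists (A - 4 * i - 4); lia.
  have -> : A - 2 * i.+1 = b + 2 * i + 2 by lia.
  have -> : A - 2 * i = b + 2 * i + 4 by lia.
  have -> : A - 2 = b + 4 * i + 2 by lia.
  rewrite bE; lia.
have X0 := expK_gt0 i.
have h2 : A * K ^ i <= A * (2 * E ^ i).
  rewrite [A * (2 * _)]mulnCA; apply: leq_trans (leq_mul (leqnn 2) h).
  by rewrite mulnA leq_mul2r; lia.
by rewrite leq_pmul2l // in h2; lia.
Qed.

End LineGraph.

(** * Distances *)

Section LineDistance.
Local Open Scope nat_scope.

Variables A m N n : nat.
Local Notation K := (2 * A).
Local Notation E := (2 * (A - 2)).
Local Notation V := 'I_n.+1.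

Hypothesis A_ge4 : 4 <= A.

Definition line_adj : rel V :=
  fun x y => line_edge A m N x y || line_edge A m N y x.

Definition line_W (x y : V) : nat := line_wt A (minn x y) (maxn x y).

Lemma line_adj_sym : symmetric line_adj.
Proof. by move=> x y; rewrite /line_adj orbC. Qed.

Lemma line_W_sym x y : line_W x y = line_W y x.
Proof. by rewrite /line_W minnC maxnC. Qed.

Lemma line_W_lt (x y : V) : x < y -> line_W x y = line_wt A x y.
Proof. by move=> xy; rewrite /line_W (minn_idPl (ltnW xy)) (maxn_idPr (ltnW xy)). Qed.

Lemma line_W_gt0 x y : line_adj x y -> 0 < line_W x y.
Proof.
by case/orP=> h; [|rewrite line_W_sym]; rewrite line_W_lt;
  do ?[exact: line_wt_gt0 h|exact: line_edge_lt h].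
Qed.

Lemma line_connected x y : connect line_adj x y.
Proof.
suff h k (z : V) : z = k :> nat -> connect line_adj ord0 z.
  by apply: connect_trans (h _ y erefl); rewrite (sym_connect_sym line_adj_sym); apply: h.
elim: k z => [|k IH] z zk; first by rewrite (_ : z = ord0) //; apply: val_inj.
have kn : k < n.+1 by rewrite -ltnS -zk ltnW // ltnS.
apply: connect_trans (IH (Ordinal kn) erefl) _; apply: connect1.
by rewrite /line_adj /line_edge /= zk eqxx.
Qed.

Definition line_dist : V -> V -> nat := sdist line_W line_connected.
Local Notation d := line_dist.

Lemma line_dist_tri y x z : d x z <= d x y + d y z.
Proof. exact: sdist_tri. Qed.
Lemma line_dist_sym x y : d x y = d y x.
Proof. exact: (sdist_sym line_adj_sym line_W_sym). Qed.
Lemma line_distxx x : d x x = 0.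
Proof. exact: sdistxx. Qed.
Lemma line_dist_edge (x y : V) :
  line_edge A m N x y -> d x y <= line_wt A x y.
Proof.
move=> h; rewrite -line_W_lt ?(line_edge_lt A_ge4 h) //.
by apply: sdist_edge; rewrite /line_adj h.
Qed.

(** * Lower bounds from potentials *)

Definition line_lipschitz (f : nat -> nat) s := forall p q,
  line_edge A m N p q ->
  f q <= f p + s * line_wt A p q /\ f p <= f q + s * line_wt A p q.

Lemma line_potential f s (x y : V) : line_lipschitz f s -> f y <= f x + s * d x y.
Proof.
move=> fs; apply: (sdist_potential line_connected (f := f \o val)) => a b /=.
by case/orP=> h; [|rewrite line_W_sym]; rewrite line_W_lt ?(line_edge_lt A_ge4 h) //;
  case: (fs _ _ h).
Qed.

(** Position is truncated to a window of length [K ^ j]. Chords of level below [j] are too slow per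
    step, and a chord of higher level weighs at least [A * E ^ j], which pays for the total
    variation of the function. *)
Lemma clamp_lipschitz l j :
  line_lipschitz (fun z => A * E ^ j * minn (z - l) (K ^ j)) (K ^ j).
Proof.
move=> p q h; have pq := ltnW (line_edge_lt A_ge4 h).
have mono : minn (p - l) (K ^ j) <= minn (q - l) (K ^ j).
  by rewrite leq_min geq_minr andbT geq_min leq_sub2r.
split; last by apply: leq_trans (leq_addr _ _); rewrite leq_mul2l mono orbT.
have key : A * E ^ j * (q - p) <= K ^ j * line_wt A p q \/
   A * E ^ j <= line_wt A p q.
  case/line_edgeP: h => // [[-> ->]|[i [g [c [[_ _ qE _ _] ->]]]]].
    left; rewrite subSnn muln1 mulnC leq_mul2r expE_leK //; exact: orbT.
  have [ij|ji] := ltnP i j; last by right; apply: chord_heavy.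
  by left; rewrite qE addKn; apply: chord_rate.
case: key => key.
  apply: leq_trans (leq_add (leqnn _) key); rewrite -mulnDr leq_mul2l; apply/orP; right.
  lia.
apply: leq_trans (leq_addl _ _); rewrite mulnC leq_mul //; exact: geq_minr.
Qed.

Lemma cell_lb l j (u v : V) : l <= u <= l + K ^ j -> l <= v <= l + K ^ j ->
  A * E ^ j * (v - u) <= K ^ j * d u v.
Proof.
move=> hu hv; have := line_potential u v (clamp_lipschitz l j).
rewrite !(minn_idPl _); [|lia..].
have [uv|vu _] := leqP u v; last by rewrite (_ : v - u = 0) ?muln0 //; lia.
have -> : v - l = (u - l) + (v - u) by lia.
by rewrite mulnDr leq_add2l.
Qed.

(** All chords have level below [m], so at this rate the untruncated position is a potential and the
    bound holds on the entire line. *)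
Lemma line_lb (u v : V) : A * E ^ m * (v - u) <= K ^ m * d u v.
Proof.
have lip : line_lipschitz (fun z => A * E ^ m * z) (K ^ m).
  move=> p q h; have pq := ltnW (line_edge_lt A_ge4 h).
  split; last by apply: leq_trans (leq_addr _ _); rewrite leq_mul2l pq orbT.
  rewrite -{1}(subnKC pq) mulnDr leq_add2l.
  case/line_edgeP: h => // [[-> ->]|[i [g [c [[im _ qE _ _] ->]]]]].
    by rewrite subSnn muln1 mulnC leq_mul2r expE_leK // orbT.
  by rewrite qE addKn; apply: chord_rate.
have := line_potential u v lip.
have [uv|vu _] := leqP u v; last by rewrite (_ : v - u = 0) ?muln0 //; lia.
by rewrite -{1}(subnKC uv) mulnDr leq_add2l.
Qed.

Lemma line_exit (S : pred V) x u : S u -> ~~ S x ->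
  exists b t, [/\ S b, ~~ S t, line_adj b t & d x u = d x t + d t u].
Proof.
move=> Su Sx; have [b [t [Sb St ebt h]]] := sdist_exit line_W line_connected Su Sx.
exists b, t; split=> //.
by rewrite line_dist_sym [d u x]h addnC [sdist _ _ t x]line_dist_sym [sdist _ _ u t]line_dist_sym.
Qed.

(** Followed backwards from [u], a shortest walk leaves the open cell by an edge that [cell_nest]
    keeps in the closed cell, hence through one of the two ends. *)
Lemma cell_port a j (x u : V) : a.+1 * K ^ j <= N ->
  ~~ (a * K ^ j < x < a.+1 * K ^ j) -> a * K ^ j <= u <= a.+1 * K ^ j ->
  exists2 t : V, t = a * K ^ j :> nat \/ t = a.+1 * K ^ j :> nat
    & d x u = d x t + d t u.
Proof.
move=> aN hx hu; have [uo|uo] := boolP (a * K ^ j < u < a.+1 * K ^ j); last first.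
  by exists u; [lia|rewrite line_distxx addn0].
have [b [t [bo to ebt ->]]] := @line_exit
  (fun z : V => a * K ^ j < z < a.+1 * K ^ j) x u uo hx.
exists t => //.
by case/orP: ebt => h; have := line_edge_lt A_ge4 h;
  [have := cell_nest A_ge4 h (or_introl bo)
  |have := cell_nest A_ge4 h (or_intror bo)]; lia.
Qed.

Lemma radix_inj k b r b' r' : b * k + r = b' * k + r' -> r < k -> r' < k -> r = r'.
Proof.
by move=> h rk rk'; have := congr1 (modn^~ k) h; rewrite !modnMDl !modn_small.
Qed.

(** Here [p] is a corner between two child cells inside a cell of level [i + 1]. From the interior
    of a child cell one exits only to its other corner. From [p] itself only a chord of level [i]
    jumps further: lower ones are too short, and higher ones start and end at multiples of a higher
    power. At rank [r = A] two chords would meet. *)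
Lemma star_exit i g r p a b : p = (g * K + r) * K ^ i -> 0 < r < K -> r != A ->
  line_edge A m N a b || line_edge A m N b a ->
  p < a + K ^ i -> a < p + K ^ i -> ~~ ((p < b + K ^ i) && (b < p + K ^ i)) ->
  b + K ^ i = p \/ b = p + K ^ i \/ (r < A /\ b = p + A * K ^ i)
  \/ (A < r /\ b + A * K ^ i = p).
Proof.
move=> pE r0 rA eab a1 a2 hb; have X0 := expK_gt0 A_ge4 i.
have [k kE] : exists k, g * K + r = k.+1 by exists (g * K + r).-1; lia.
have pk : p = k.+1 * K ^ i by rewrite pE kE.
have pk1 : p = k * K ^ i + K ^ i by rewrite pk mulSn addnC.
have pk2 : k.+2 * K ^ i = p + K ^ i by rewrite mulSn -pk addnC.
have [ap|pa|ap] := ltngtP a p.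
- have ao : k * K ^ i < a < k.+1 * K ^ i by lia.
  by case/orP: eab => h; have := line_edge_lt A_ge4 h;
    [have := cell_nest A_ge4 h (or_introl ao)
    |have := cell_nest A_ge4 h (or_intror ao)]; lia.
- have ao : k.+1 * K ^ i < a < k.+2 * K ^ i by lia.
  by case/orP: eab => h; have := line_edge_lt A_ge4 h;
    [have := cell_nest A_ge4 h (or_introl ao)
    |have := cell_nest A_ge4 h (or_intror ao)]; lia.
have small i' : i' < i -> A * K ^ i' < K ^ i.
  move=> ii; apply: (@leq_trans (K ^ i'.+1)); last by rewrite leq_exp2l //; lia.
  by rewrite expnS ltn_pmul2r ?expK_gt0 //; lia.
have big i' x : i < i' -> p <> x * K ^ i'.
  move=> ii; have -> : K ^ i' = K ^ (i' - i.+1) * K * K ^ i.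
    by rewrite -mulnA -expnS -expnD; congr (_ ^ _); lia.
  rewrite pE [x * _]mulnA => /eqP; rewrite eqn_pmul2r // [x * _]mulnA -[X in _ == X]addn0.
  by move=> /eqP /radix_inj h; have := h _ _; lia.
rewrite {a a1 a2}ap in eab.
case/orP: eab => /(line_edgeP A_ge4) [[h _]|[i' [g' [c' [[_ h1 h2 cA _] _]]]]].
- lia.
- have [ii|ii|ii] := ltngtP i' i; first by have := small _ ii; lia.
    by case: (big _ _ ii h1).
  move: h1 h2; rewrite ii pE => /eqP; rewrite eqn_pmul2r // => /eqP /radix_inj h bE.
  by have := h _ _; lia.
- lia.
have [ii|ii|ii] := ltngtP i' i; first by have := small _ ii; lia.
  by case: (big i' (g' * K + c' + A) ii); rewrite mulnDl -h1.
move: h1 h2; rewrite ii => bE pE'.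
have /eqP : (g * K + r) * K ^ i = (g' * K + (c' + A)) * K ^ i.
  by rewrite -pE pE' bE -mulnDl addnA.
rewrite eqn_pmul2r // => /eqP h.
(* Otherwise [c' = A] and the chord ends at the right end of its parent cell, where the residue is 0
   instead of [r]. *)
have [c2|c2] := ltnP (c' + A) K; first by have := radix_inj h _ c2; lia.
have h' : g * K + r = g'.+1 * K + 0 by rewrite h mulSn; lia.
by have := radix_inj h' _ _; lia.
Qed.

Hypothesis N_le : N <= n.

(** The upper bound goes through the midpoint [w] by the first and then the last chord of the cell,
    where the tie-breaking terms vanish; the lower bound is [cell_lb]. *)
Lemma port_dist a j (u v : V) : j <= m -> a.+1 * K ^ j <= N ->
  u = a * K ^ j :> nat -> v = a.+1 * K ^ j :> nat -> d u v = A * E ^ j.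
Proof.
move=> jm aN uE vE; have X0 := expK_gt0 A_ge4 j.
have vuE : v = u + K ^ j :> nat by rewrite uE vE mulSn addnC.
apply/eqP; rewrite eqn_leq; apply/andP; split; last first.
  have := @cell_lb u j u v; rewrite vuE leqnn leq_addr addKn => /(_ isT).
  by rewrite leqnn => /(_ isT); rewrite mulnC leq_pmul2l.
case: j => [|j] in jm aN uE vE X0 vuE *.
  have h : line_edge A m N u v by apply/orP; left; rewrite vuE addn1.
  by apply: leq_trans (line_dist_edge h) _; rewrite /line_wt vuE addn1 eqxx muln1.
have Y0 := expK_gt0 A_ge4 j; set Y := K ^ j in Y0 *.
have XE : K ^ j.+1 = K * Y by rewrite expnS.
have wn : u + A * Y < n.+1 by rewrite ltnS; apply: leq_trans N_le; rewrite uE XE; rewrite XE in aN; nia.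
pose w := Ordinal wn.
have e1 : chord A m N j u.
  apply/(chordP m N A_ge4); exists a, 0; split=> //; last by rewrite -expnS.
  by rewrite uE addn0 expnS mulnA.
have e2 : chord A m N j w.
  apply/(chordP m N A_ge4); exists a, A; split=> //; last by rewrite -expnS.
  by rewrite /= uE XE; ring.
have h1 := line_edge_chord e1; have h2 := line_edge_chord e2.
have wE : u + A * K ^ j = w by [].
have vE' : w + A * K ^ j = v by rewrite /= vuE XE -/Y; ring.
rewrite wE in h1; rewrite vE' in h2.
apply: leq_trans (line_dist_tri w u v) _.
apply: leq_trans (leq_add (line_dist_edge h1) (line_dist_edge h2)) _.
rewrite -{1}wE -vE' !line_wt_chord //.
have -> : u %/ K ^ j = a * 2 * A by rewrite uE expnS !mulnA mulnK // /= -[2]/(2).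
have -> : w %/ K ^ j = (a * 2 + 1) * A.
  by rewrite /= uE expnS -/Y (_ : _ + _ = (a * 2 + 1) * A * Y) ?mulnK //; ring.
rewrite !modnMl expnS; lia.
Qed.

(* If both [x] and [y] were outside the cell, the walk would cross it, and its own
   chords are faster than an edge with a smaller ratio. *)
Lemma cell_shortest a j w (x y u v : V) : j <= m -> a.+1 * K ^ j <= N ->
  a * K ^ j <= u <= a.+1 * K ^ j -> a * K ^ j <= v <= a.+1 * K ^ j ->
  A * E ^ j * ((u - v) + (v - u)) < K ^ j * w ->
  d x u + w + d v y = d x y ->
  (a * K ^ j < x < a.+1 * K ^ j) || (a * K ^ j < y < a.+1 * K ^ j).
Proof.
move=> jm aN hu hv wlt dxy; apply: contraT => /norP[xo yo].
have X0 := expK_gt0 A_ge4 j.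
have w0 : 0 < w by move: wlt; case: (w) => [|//]; rewrite muln0.
have [t tE dxu] := cell_port aN xo hu.
have [t' t'E dyv] := cell_port aN yo hv.
rewrite (line_dist_sym y v) (line_dist_sym y t') (line_dist_sym t' v) in dyv.
have tri : d x y <= d x t + (d t t' + d t' y).
  by apply: leq_trans (line_dist_tri t x y) _; rewrite leq_add2l line_dist_tri.
suff : d t t' < d t u + w + d v t' by lia.
have [tt'|tt'] := eqVneq (t : nat) t'.
  by rewrite (val_inj tt') line_distxx; lia.
have -> : d t t' = A * E ^ j.
  by case: tE t'E => tE [] t'E; rewrite ?tE ?t'E ?eqxx // in tt' *;
    [exact: port_dist tE t'E|rewrite line_dist_sym; exact: port_dist t'E tE].
have lb (z z' : V) : a * K ^ j <= z <= a.+1 * K ^ j ->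
    a * K ^ j <= z' <= a.+1 * K ^ j -> A * E ^ j * ((z - z') + (z' - z)) <= K ^ j * d z z'.
  have aE : a.+1 * K ^ j = a * K ^ j + K ^ j by rewrite mulSn addnC.
  rewrite aE => hz hz'; have h1 := cell_lb hz hz'.
  have := cell_lb hz' hz; rewrite line_dist_sym => h2.
  have [zz|zz] := leqP z z'.
    by have /eqP -> : z - z' == 0 by rewrite subn_eq0.
  by have /eqP -> : z' - z == 0; rewrite ?addn0 // subn_eq0 ltnW.
have ht : a * K ^ j <= t <= a.+1 * K ^ j by case: tE => ->; rewrite leqnn leq_mul2r leqnSn orbT.
have ht' : a * K ^ j <= t' <= a.+1 * K ^ j by case: t'E => ->; rewrite leqnn leq_mul2r leqnSn orbT.
have h1 := lb _ _ ht hu; have h2 := lb _ _ hv ht'.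
rewrite -(ltn_pmul2l X0) !mulnDr.
(* The stretches from [t] to [u], [u] to [v] and [v] to [t'] together span the cell. The outer two
   obey the cell bound, and [wlt] makes the middle one strictly slower. *)
suff : K ^ j * (A * E ^ j) <= A * E ^ j * ((t - u) + (u - t)) +
  A * E ^ j * ((u - v) + (v - u)) + A * E ^ j * ((v - t') + (t' - v)).
  by move=> /leq_ltn_trans; apply; move: h1 h2 wlt; clear; lia.
rewrite -!mulnDr [K ^ j * _]mulnC leq_mul2l; apply/orP; right.
have aE : a.+1 * K ^ j = a * K ^ j + K ^ j by rewrite mulSn addnC.
move: {lb h1 h2 dxy tri dxu dyv wlt} tt'; lia.
Qed.

(* Otherwise the walk could be shortened by using chord [c - 1] or [c + 1]. *)
Lemma interior_chord_shortest i j c (x y u v : V) : i < m -> j.+1 * (K * K ^ i) <= N ->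
  0 < c < A -> u = (j * K + c) * K ^ i :> nat -> v = u + A * K ^ i :> nat ->
  d x u + line_wt A u v + d v y = d x y ->
  (u < x + K ^ i) && (x < u + K ^ i) || (v < y + K ^ i) && (y < v + K ^ i).
Proof.
move=> im jN c0 uE vE dxy; apply: contraT => /norP[xo yo].
have X0 := expK_gt0 A_ge4 i; set X := K ^ i in X0 *.
have uN : u + A * X + X <= N.
  apply: leq_trans jN; rewrite uE -mulnDl -mulSnr [j.+1 * _]mulnA leq_mul2r.
  by apply/orP; right; lia.
have [k kE] : exists k, j * K + c = k.+1 by exists (j * K + c).-1; lia.
have uX : u = k * X + X :> nat by rewrite uE kE mulSn addnC.
have vX : v = (k + A) * X + X :> nat by rewrite vE uX mulnDl; lia.
have E0 := expE_gt0 A_ge4 i.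
pose w c := E ^ i * (A * (A - 2) + c %% A).
have chordW c' (a b : V) : c' <= A -> a = (j * K + c') * X :> nat ->
    b = a + A * X :> nat -> d a b <= w c' /\ line_wt A a b = w c'.
  move=> cA aE bE; have h : chord A m N i a.
    by apply/chordP => //; exists j, c'.
  have wE : line_wt A a b = w c'.
    by rewrite bE line_wt_chord // aE mulnK // [j * K]mulnA modnMDl.
  split=> //; rewrite -wE; apply: line_dist_edge.
  by rewrite bE; apply: line_edge_chord.
have step b (a a' : V) : a = b * X :> nat -> a' = b * X + X :> nat ->
    b * X + X <= N -> d a a' = A * E ^ i.
  have bS : b.+1 * X = b * X + X by rewrite mulSnr.
  by move=> aE a'E bN; apply: (port_dist (a := b)); rewrite -/X ?bS //; lia.
have umn : k * X < n.+1 by lia.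
have vmn : (k + A) * X < n.+1 by lia.
have upn : k.+1 * X + X < n.+1 by rewrite mulSn; lia.
have vpn : (k + A).+1 * X + X < n.+1 by rewrite mulSn; lia.
(* The corners one child cell to the left and to the right of [u] and [v] are the ends of the chords
   of rank [c - 1] and [c + 1]. *)
pose um := Ordinal umn; pose vm := Ordinal vmn.
pose up := Ordinal upn; pose vp := Ordinal vpn.
have vmE : vm = um + A * X :> nat by rewrite /= mulnDl.
have vpE : vp = up + A * X :> nat by rewrite /= !mulSn mulnDl; lia.
have d1 : d um u = A * E ^ i by apply: (step k) => //; lia.
have d2 : d u up = A * E ^ i by apply: (step k.+1) => //; rewrite ?mulSn; lia.
have d3 : d vm v = A * E ^ i by apply: (step (k + A)) => //; lia.
have d4 : d v vp = A * E ^ i by apply: (step (k + A).+1) => //; rewrite ?mulSn; lia.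
have [_ wc] : d u v <= w c /\ line_wt A u v = w c by apply: chordW => //; lia.
have [wm _] : d um vm <= w c.-1 /\ line_wt A um vm = w c.-1.
  by apply: chordW => //; [lia|rewrite /=; congr (_ * _); lia].
have [wp _] : d up vp <= w c.+1 /\ line_wt A up vp = w c.+1.
  by apply: chordW => //; [lia|rewrite /= -mulSnr; congr (_ * _); lia].
have wmc : w c.-1 < w c by rewrite /w ltn_pmul2l // ltn_add2l !modn_small //; lia.
(* Only an inequality: for [c + 1 = A] the tie-breaking term drops to 0. *)
have wpc : w c.+1 <= w c + E ^ i.
  rewrite /w -[X in _ <= _ + X]muln1 -mulnDr leq_mul2l -addnA leq_add2l.
  by rewrite (modn_small (_ : c < A)) ?(leq_trans (leq_mod _ _)) ?addn1 ?orbT //; lia.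
have w0 : 0 < w c by exact: leq_ltn_trans wmc.
have EA : E ^ i <= A * E ^ i by rewrite leq_pmull //; lia.
rewrite wc in dxy.
have su : (u < u + X) && (u < u + X) by lia.
have sv : (v < v + X) && (v < v + X) by lia.
have [b [t [/andP[b1 b2] to et dxu]]] :=
  @line_exit (fun z : V => (u < z + X) && (z < u + X)) x u su xo.
have [b' [t' [/andP[b1' b2'] to' et' dyv]]] :=
  @line_exit (fun z : V => (v < z + X) && (z < v + X)) y v sv yo.
have vE2 : v = (j * K + (A + c)) * X :> nat by rewrite vE uE; ring.
rewrite (line_dist_sym y v) (line_dist_sym y t') (line_dist_sym t' v) in dyv.
have tE : t = um \/ t = up.
  have [||h|[h|[[_ h]|[]]]] := star_exit uE _ _ et b1 b2 to; [lia|lia|left|right| |lia].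
  - by apply: val_inj => /=; lia.
  - by apply: val_inj => /=; rewrite mulSn; lia.
  (* If [u] is reached through [v], the chord merely leads back to [v], and omitting it shortens the
     walk. *)
  have tv : t = v by apply: val_inj; rewrite /= h vE.
  by have := line_dist_tri v x y; rewrite tv in dxu; lia.
have t'E : t' = vm \/ t' = vp.
  have [||h|[h|[[]|[_ h]]]] := star_exit vE2 _ _ et' b1' b2' to'; [lia|lia|left|right|lia| ].
  - by apply: val_inj => /=; lia.
  - by apply: val_inj => /=; rewrite mulSn; lia.
  have tu : t' = u by apply: val_inj => /=; lia.
  by have := line_dist_tri u x y; rewrite tu in dyv; lia.
have tri4 (a b0 : V) : d x y <= d x t + d t a + d a b0 + d b0 t' + d t' y.
  have h1 := line_dist_tri t x y; have h2 := line_dist_tri a t y.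
  have h3 := line_dist_tri b0 a y; have h4 := line_dist_tri t' b0 y; lia.
(* If [t] or [t'] is a left neighbour, chord [c - 1] is strictly lighter and the shifts cost no more
   than those of the walk. If both are right neighbours, chord [c + 1] costs at most [E ^ i] more
   but saves two shifts of [A * E ^ i]. *)
case: tE t'E => tE [] t'E; rewrite {}tE in dxu tri4; rewrite {}t'E in dyv tri4.
- by have := tri4 um vm; rewrite !line_distxx; lia.
- have := tri4 um vm; have := line_dist_tri v vm vp; rewrite !line_distxx; lia.
- have := tri4 um vm; have := line_dist_tri u up um.
  rewrite (line_dist_sym up u) (line_dist_sym u um) !line_distxx.
  rewrite (line_dist_sym up u) in dxu; rewrite (line_dist_sym v vm) in dyv.
  lia.
by have := tri4 up vp; rewrite !line_distxx; rewrite (line_dist_sym up u) in dxu; lia.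
Qed.

End LineDistance.

(** * Charging the edges of shortest walks *)

Section Charging.
Local Open Scope nat_scope.

(** Below the topmost level in range, the terms are dominated by a sequence that doubles, in total
    at most [2 * B * Y]; the topmost level adds [B * Y], and those above add nothing. *)
Lemma geometric_sum_le (a g : nat -> nat) B Y m :
  (forall i, 2 * g i <= g i.+1) -> (forall i, Y < g i -> a i = 0) ->
  (forall i, a i <= B * Y) ->
  (forall i, i.+1 < m -> g i.+1 <= Y -> a i <= B * g i.+1) ->
  \sum_(i < m) a i <= 3 * B * Y.
Proof.
move=> gg a0 aY ag.
have below M : M < m -> g M <= Y -> \sum_(i < M) a i <= 2 * B * g M.
  elim: M => [|M IH] Mm gY; first by rewrite big_ord0.
  rewrite big_ord_recr /=; have := ag M Mm gY; have gM := gg M.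
  have := IH ltac:(lia) ltac:(lia).
  have : B * (2 * g M) <= B * g M.+1 by rewrite leq_mul2l gM orbT.
  rewrite [2 * B]mulnC -!mulnA; move: (B * (2 * g M)) => u.
  rewrite [B * (2 * _)]mulnCA; move: (B * g M.+1) (\sum_(i < M) a i) (a M) => p q r; clear.
  lia.
suff h M : M <= m -> \sum_(i < M) a i <= 3 * B * Y by exact: h.
elim: M => [|M IH] Mm; first by rewrite big_ord0.
rewrite big_ord_recr /=; have [gY|Yg] := leqP (g M) Y; last by rewrite a0 // addn0 IH // ltnW.
have := below M Mm gY; have := aY M.
have : B * g M <= B * Y by rewrite leq_mul2l gY orbT.
rewrite -!mulnA; move: (B * g M) (B * Y) (\sum_(i < M) a i) (a M) => p q r t; clear; lia.
Qed.

Lemma count_multiples k H lo hi : 0 < H ->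
  size [seq t <- iota 0 k | (lo <= t * H) && (t * H + H <= hi)] * H <= hi - lo.
Proof.
move=> H0; set s := [seq t <- _ | _].
have us : uniq s by rewrite filter_uniq // iota_uniq.
have ub : size s <= hi %/ H - (lo + H.-1) %/ H.
  rewrite -[X in _ <= X](size_iota ((lo + H.-1) %/ H)); apply: uniq_leq_size => // t.
  rewrite mem_filter mem_iota => /andP[/andP[t1 t2] _].
  have h1 : (lo + H.-1) %/ H <= t by rewrite -ltnS ltn_divLR // mulSn; lia.
  have h2 : t < hi %/ H by rewrite leq_divRL // mulSn; lia.
  by rewrite mem_iota h1 subnKC // ltnW // (leq_ltn_trans h1).
apply: leq_trans (leq_mul ub (leqnn H)) _; rewrite mulnBl.
have := leq_divM hi H; have := ltn_ceil (lo + H.-1) H0; lia.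
Qed.

Variables A m N n : nat.
Local Notation K := (2 * A).
Local Notation E := (2 * (A - 2)).
Local Notation V := 'I_n.+1.
Local Notation d := (@line_dist A m N n).

Hypothesis A_ge4 : 4 <= A.

Variable L : nat.
(** A radius in positions: by [line_dist_lb] a step is worth at least [A / 2], so vertices at
    distance at most [L] are at most [X] apart on the line. *)
Let X := (2 * L) %/ A.

Lemma range_mul : A * X <= 2 * L.
Proof. by rewrite mulnC; exact: leq_divM. Qed.

(** With [H = 1] these are unit edges. With [H = A * K ^ i] they include the first and last chords
    of level [i] in the window, since ranks 0 and [A] start at multiples of [A * K ^ i]. *)
Definition multiples H lo hi : seq (nat * nat) :=
  [seq (t * H, t * H + H) |
    t <- [seq t <- iota 0 n.+1 | (lo <= t * H) && (t * H + H <= hi)]].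

(** The chords that start or end at a corner of the level [i] cell around [z]. Pairs that are not
    edges may occur, here and in [multiples]; they only enlarge an upper bound. *)
Definition interior_charge i z : seq (nat * nat) :=
  let b := z %/ K ^ i in
  [seq (p, p + A * K ^ i) | p <- [:: b * K ^ i; b.+1 * K ^ i;
     b * K ^ i - A * K ^ i; b.+1 * K ^ i - A * K ^ i]].

(* The range pays only when [L] is comparable to the parent cell; charging the
   parent cell at the other levels makes the total a geometric series. *)
Definition express_charge i z : seq (nat * nat) :=
  let M := K ^ i.+2 in
  if (i.+1 < m) && (A * E ^ i.+2 <= 2 * L)
  then multiples (A * K ^ i) (z %/ M * M) ((z %/ M).+1 * M)
  else multiples (A * K ^ i) (z - X) (z + X).

(** A chord of level [i] weighs at least [A * E ^ i.+1 / 2], so a walk of length at most [L] can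
    contain one only under this test. *)
Definition level_charge i z : seq (nat * nat) :=
  if A * E ^ i.+1 <= 2 * L then interior_charge i z ++ express_charge i z else [::].

Definition charged_edges z : seq (nat * nat) :=
  multiples 1 (z - X) (z + X) ++ flatten [seq level_charge i z | i <- iota 0 m].

Lemma mem_multiples H lo hi t : 0 < H -> lo <= t * H -> t * H + H <= hi -> t * H <= n ->
  (t * H, t * H + H) \in multiples H lo hi.
Proof.
move=> H0 h1 h2 tn; apply/mapP; exists t => //.
rewrite mem_filter h1 h2 mem_iota /= add0n ltnS; apply: leq_trans tn.
exact: leq_pmulr.
Qed.

Lemma charge_level i z c : i < m -> c \in level_charge i z -> c \in charged_edges z.
Proof.
move=> im cz; rewrite mem_cat; apply/orP; right; apply/flattenP.
by exists (level_charge i z) => //; apply/mapP; exists i; rewrite ?mem_iota.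
Qed.

Lemma mem_interior i z k : 0 < k -> k * K ^ i < z + K ^ i -> z < k * K ^ i + K ^ i ->
  k * K ^ i = z %/ K ^ i * K ^ i \/ k * K ^ i = (z %/ K ^ i).+1 * K ^ i.
Proof.
move=> k0 h1 h2; have X0 := expK_gt0 A_ge4 i.
have h3 := leq_divM z (K ^ i); have h4 := ltn_ceil z X0.
set b := z %/ K ^ i in h3 h4 *; set s := K ^ i in X0 h1 h2 h3 h4 *.
have h5 : b * s < k.+1 * s by rewrite mulSn; lia.
have h6 : k * s < b.+2 * s by rewrite mulSn; lia.
rewrite !ltn_pmul2r // in h5 h6.
have [->|->] : k = b \/ k = b.+1 by lia.
  by left.
by right.
Qed.

Definition charge_wt (s : seq (nat * nat)) := \sum_(c <- s) line_wt A c.1 c.2.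

Lemma charge_wt_cat s1 s2 : charge_wt (s1 ++ s2) = charge_wt s1 + charge_wt s2.
Proof. by rewrite /charge_wt big_cat. Qed.

Lemma interior_charge_wt i z : charge_wt (interior_charge i z) <= 4 * (A * E ^ i.+1).
Proof.
have h p : line_wt A p (p + A * K ^ i) <= A * E ^ i.+1.
  have -> : A * E ^ i.+1 = E ^ i * (2 * (A * (A - 2))) by rewrite expnS; ring.
  rewrite line_wt_chord // leq_mul2l [2 * (A * _)]mul2n -addnn leq_add2l; apply/orP; right.
  have A0 : 0 < A by lia.
  by apply: leq_trans (ltnW (ltn_pmod _ A0)) _; apply: leq_pmulr; lia.
rewrite /charge_wt /interior_charge big_map !big_cons big_nil.
have h1 := h (z %/ K ^ i * K ^ i); have h2 := h ((z %/ K ^ i).+1 * K ^ i).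
have h3 := h (z %/ K ^ i * K ^ i - A * K ^ i).
have h4 := h ((z %/ K ^ i).+1 * K ^ i - A * K ^ i).
rewrite /=; lia.
Qed.

Lemma multiples_wt H lo hi w : 0 < H -> (forall t, line_wt A (t * H) (t * H + H) = w) ->
  charge_wt (multiples H lo hi) * H <= (hi - lo) * w.
Proof.
move=> H0 wE; rewrite /charge_wt /multiples big_map.
rewrite (eq_bigr (fun=> w)) => [|t _]; last exact: wE.
rewrite big_const_seq count_predT iter_addn_0 mulnC mulnCA mulnC leq_mul2r mulnC.
by rewrite count_multiples // orbT.
Qed.

Lemma express_wt i t :
  line_wt A (t * (A * K ^ i)) (t * (A * K ^ i) + A * K ^ i) = E ^ i * (A * (A - 2)).
Proof. by rewrite line_wt_chord // mulnA mulnK ?expK_gt0 // modnMl addn0. Qed.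

(** Per step of the line these chords cost at most [A], and the window has at most [2 * X] steps
    with [A * X <= 2 * L]. *)
Lemma express_charge_wt_range i z :
  charge_wt (multiples (A * K ^ i) (z - X) (z + X)) <= 4 * L.
Proof.
have X0 := expK_gt0 A_ge4 i.
have H0 : 0 < A * K ^ i by rewrite muln_gt0 X0; lia.
rewrite -(leq_pmul2r H0); apply: leq_trans (multiples_wt _ _ H0 (express_wt i)) _.
apply: (@leq_trans (2 * X * (K ^ i * (A * A)))).
  apply: leq_mul; first lia.
  by apply: leq_mul; [exact: expE_leK|rewrite leq_mul2l leq_subr orbT].
have h := range_mul.
have -> : 2 * X * (K ^ i * (A * A)) = 2 * (A * X) * (A * K ^ i) by ring.
by rewrite leq_mul2r; apply/orP; right; lia.
Qed.

(** A cell of level [i + 2] has room for [4 * A] such chords; the bound then amounts to [A <= E]. *)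
Lemma express_charge_wt_cell i z :
  charge_wt (multiples (A * K ^ i) (z %/ K ^ i.+2 * K ^ i.+2)
     ((z %/ K ^ i.+2).+1 * K ^ i.+2)) <= 2 * (A * E ^ i.+2).
Proof.
have X0 := expK_gt0 A_ge4 i.
have H0 : 0 < A * K ^ i by rewrite muln_gt0 X0; lia.
rewrite -(leq_pmul2r H0); apply: leq_trans (multiples_wt _ _ H0 (express_wt i)) _.
rewrite -mulnBl subSnn mul1n !expnS.
have -> : K * (K * K ^ i) * (E ^ i * (A * (A - 2))) = (2 * (A * A) * E ^ i * (A * K ^ i)) * E by ring.
have -> : 2 * (A * (E * (E * E ^ i))) * (A * K ^ i) = (2 * (A * E) * E ^ i * (A * K ^ i)) * E by ring.
rewrite !leq_mul2r; apply/orP; right; apply/orP; right; apply/orP; right.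
by rewrite leq_mul2l leq_mul2l; lia.
Qed.

Lemma charge_wt_le z : charge_wt (charged_edges z) <= 40 * L.
Proof.
rewrite charge_wt_cat.
have h1 : charge_wt (multiples 1 (z - X) (z + X)) <= 4 * L.
  have := @multiples_wt 1 (z - X) (z + X) A isT; rewrite muln1 => h.
  apply: leq_trans (h _) _ => [t|].
    by rewrite /line_wt muln1 addn1 eqxx.
  have := range_mul; have : (z + X - (z - X)) * A <= 2 * X * A by rewrite leq_mul2r; lia.
  lia.
suff h2 : charge_wt (flatten [seq level_charge i z | i <- iota 0 m]) <= 36 * L.
  by apply: leq_trans (leq_add h1 h2) _; lia.
have -> : charge_wt (flatten [seq level_charge i z | i <- iota 0 m]) =
    \sum_(i < m) charge_wt (level_charge i z).
  rewrite -(big_mkord predT (fun i => charge_wt (level_charge i z))) /index_iota subn0.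
  elim: (iota 0 m) => [|i s IH] /=; first by rewrite /charge_wt !big_nil.
  by rewrite charge_wt_cat IH big_cons.
have E2 : 2 <= E by lia.
(* The constant 6 adds 4 from the interior and 2 from the express chords, which gives [36 * L]; the
   unit edges account for the other [4 * L]. *)
have := @geometric_sum_le (fun i => charge_wt (level_charge i z))
  (fun i => A * E ^ i.+1) 6 (2 * L) m.
have -> : 3 * 6 * (2 * L) = 36 * L by lia.
have gg i : 2 * (A * E ^ i.+1) <= A * E ^ i.+2.
  have -> : A * E ^ i.+2 = E * (A * E ^ i.+1) by rewrite [E ^ i.+2]expnS; ring.
  by rewrite leq_mul2r E2 orbT.
apply=> // [i gt|i|i im gi]; rewrite /level_charge.
- by rewrite leqNgt gt /= /charge_wt big_nil.
- case: ifP => [cond|_]; last by rewrite /charge_wt big_nil.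
  rewrite charge_wt_cat /express_charge; have := interior_charge_wt i z.
  case: ifP => [/andP[_ gi]|_].
    have := express_charge_wt_cell i z; lia.
  have := express_charge_wt_range i z; lia.
have gi' : A * E ^ i.+1 <= 2 * L by have := gg i; lia.
rewrite gi' /express_charge im gi charge_wt_cat.
have := interior_charge_wt i z; have := express_charge_wt_cell i z; have := gg i.
rewrite /=; lia.
Qed.

(** * Coverage of shortest walks by the charges *)

Hypothesis m_le : 4 * m <= A.

Lemma line_dist_lb (u v : V) : A * (v - u) <= 2 * d u v.
Proof.
have h := @line_lb A m N n A_ge4 u v; have E0 := expE_gt0 A_ge4 m.
rewrite -(leq_pmul2l E0) mulnA [E ^ m * A]mulnC; apply: leq_trans h _.
by rewrite mulnA [E ^ m * 2]mulnC leq_mul2r (expK_le2E A_ge4 m_le) // orbT.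
Qed.

Lemma near_range (x u : V) : d x u <= L -> x - X <= u <= x + X.
Proof.
move=> xu; have h z : A * z <= 2 * L -> z <= X by rewrite mulnC leq_divRL //; lia.
have h1 := h _ (leq_trans (line_dist_lb x u) (leq_mul (leqnn 2) xu)).
rewrite line_dist_sym in xu.
have h2 := h _ (leq_trans (line_dist_lb u x) (leq_mul (leqnn 2) xu)).
lia.
Qed.

Hypothesis N_le : N <= n.
Hypothesis N_mul : K ^ m %| N.

(** Unit edges lie within range of [x]. Chords of rank strictly between 0 and [A] are handled by
    [interior_chord_shortest]; the first and last chords by their range or, if the cell of level
    [i + 2] is small compared with [L], by [cell_shortest] on that cell. *)
Lemma shortest_charged (x y u v : V) : line_edge A m N u v ->
  d x u + line_wt A u v + d v y = d x y -> d x y <= L ->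
  (val u, val v) \in charged_edges x \/ (val u, val v) \in charged_edges y.
Proof.
move=> uv dxy xyL; have w0 := line_wt_gt0 A_ge4 uv.
have xu : d x u <= L by lia.
have xv : d x v <= L.
  have := @line_dist_tri A m N n u x v; have := line_dist_edge A_ge4 uv; lia.
have ru := near_range xu; have rv := near_range xv.
have := ltn_ord u; have := ltn_ord v; move=> vn un.
case: (line_edgeP A_ge4 uv) => [[vE _]|[i [j [c [[im uE vE cA jN] wE]]]]].
  left; rewrite mem_cat; apply/orP; left.
  by have := @mem_multiples 1 (x - X) (x + X) u; rewrite /= muln1 addn1 vE; apply; lia.
have X0 := expK_gt0 A_ge4 i; have H0 : 0 < A * K ^ i by rewrite muln_gt0 X0; lia.
have cond : A * E ^ i.+1 <= 2 * L.
  have -> : A * E ^ i.+1 = 2 * (E ^ i * (A * (A - 2))) by rewrite expnS; ring.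
  rewrite leq_mul2l; apply: (@leq_trans (line_wt A u v)).
    by rewrite wE leq_mul2l leq_addr orbT.
  by apply: leq_trans xyL; rewrite -dxy -addnA addnCA leq_addr.
suff : (val u, val v) \in level_charge i x \/ (val u, val v) \in level_charge i y.
  by case=> /(charge_level im); [left|right].
rewrite /level_charge cond !mem_cat.
have [c0|c0] := boolP (0 < c < A).
  have uv' : v = (j * K + c + A) * K ^ i :> nat by rewrite vE uE -mulnDl.
  have := interior_chord_shortest A_ge4 N_le im jN c0 uE vE dxy.
  have [k0 k0'] : 0 < j * K + c /\ 0 < j * K + c + A by case/andP: c0; clear; lia.
  case/orP=> /andP[h1 h2]; [left|right]; apply/orP; left; apply/mapP; exists (val u);
    rewrite /= -?vE // !inE.
    rewrite uE in h1 h2 *.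
    by case: (mem_interior k0 h1 h2) => ->; rewrite eqxx ?orbT.
  have -> : (u : nat) = v - A * K ^ i by rewrite vE addnK.
  rewrite uv' in h1 h2 *.
  by case: (mem_interior k0' h1 h2) => ->; rewrite eqxx ?orbT.
have [t tE] : exists t, u = t * (A * K ^ i) :> nat.
  have [cE|cE] : c = 0 \/ c = A by move: c0 cA; clear; lia.
    by exists (2 * j); rewrite uE cE; ring.
  by exists (2 * j + 1); rewrite uE cE; ring.
suff : (val u, val v) \in express_charge i x \/ (val u, val v) \in express_charge i y.
  by case=> ->; [left|right]; rewrite orbT.
rewrite /= vE tE /express_charge; case: ifP => [/andP[im2 _]|_]; last first.
  move: ru rv un; rewrite vE tE => /andP[r1 _] /andP[_ r2] un; left.
  exact: mem_multiples.
have M0 := expK_gt0 A_ge4 i.+2; set M := K ^ i.+2 in M0 *.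
set a := u %/ M.
(* Divisibility of [N] makes the cell of level [i + 2] around [u] complete, as [cell_shortest]
   requires. *)
have NM : N = N %/ M * M.
  apply/esym/divnK; apply: dvdn_trans N_mul; exact: dvdn_exp2l.
have uN : u < N.
  apply: leq_trans jN; rewrite uE [j.+1 * _]mulnA ltn_pmul2r // mulSn addnC ltn_add2r.
  by move: cA A_ge4; clear; lia.
have u1 : a * M <= u := leq_divM u M.
have u2 : u < a.+1 * M := ltn_ceil u M0.
have aN : a.+1 * M <= N by rewrite NM leq_mul2r ltn_divLR // -NM uN orbT.
have [v1 v2] : a * M <= v /\ v <= a.+1 * M.
  split; first exact: leq_trans u1 (ltnW (line_edge_lt A_ge4 uv)).
  have [ua|ua] := eqVneq (u : nat) (a * M).
    rewrite vE ua [a.+1 * _]mulSnr leq_add2l /M !expnS mulnA leq_mul2r.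
    by apply/orP; right; apply: leq_trans (leq_pmulr _ _); move: A_ge4; clear; lia.
  have ao : a * K ^ i.+2 < u < a.+1 * K ^ i.+2 by rewrite ltn_neqAle eq_sym ua u1 u2.
  by have [] := cell_nest A_ge4 uv (or_introl ao).
have {u1 v1} h : (a * M < x < a.+1 * M) || (a * M < y < a.+1 * M).
  apply: (cell_shortest A_ge4 N_le im2 aN _ _ _ dxy).
  - by rewrite -/M u1 ltnW.
  - by rewrite -/M v1 v2.
  rewrite vE subnDA subnn sub0n add0n addKn -vE wE; exact: chord_rate_lt.
have inc (z : nat) : a * M < z < a.+1 * M -> z %/ M = a.
  move=> /andP[z1 z2]; apply/eqP; rewrite eqn_leq -ltnS ltn_divLR // z2.
  by rewrite leq_divRL // ltnW.
have tn : t * (A * K ^ i) <= n by rewrite -tE -ltnS.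
have mem : (t * (A * K ^ i), t * (A * K ^ i) + A * K ^ i)
    \in multiples (A * K ^ i) (a * M) (a.+1 * M).
  apply: mem_multiples => //; last by rewrite -tE -vE.
  by rewrite -tE; exact: leq_divM.
by case/orP: h => /inc ->; [left|right].
Qed.

End Charging.

(** * Detours *)

Section Detours.
Local Open Scope nat_scope.

Variables A m N n : nat.
Local Notation K := (2 * A).
Local Notation E := (2 * (A - 2)).
Local Notation V := 'I_n.+1.
Local Notation W := (@line_W A n).

Hypothesis A_ge4 : 4 <= A.

Variables (e : rel V) (u v : V).
Hypothesis e_sub : forall a b, e a b -> line_adj A m N a b.
Hypothesis e_avoid : forall a b, e a b ->
  ~ (a = u /\ b = v) /\ ~ (a = v /\ b = u).

Lemma detour_potential (f : nat -> nat) s w :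
  (forall a b : V, line_edge A m N a b -> ~ (a = u /\ b = v) ->
     f b <= f a + s * line_wt A a b /\ f a <= f b + s * line_wt A a b) ->
  path e u w -> last u w = v -> f v <= f u + s * wlen W u w.
Proof.
move=> fs uw <-; apply: (walk_potential (f := f \o val) _ uw) => a b eab /=.
have [h1 h2] := e_avoid eab.
case/orP: (e_sub eab) => h; last rewrite line_W_sym.
  by rewrite line_W_lt ?(line_edge_lt A_ge4 h) //; case: (fs _ _ h h1).
rewrite line_W_lt ?(line_edge_lt A_ge4 h) //.
by have [|] := fs _ _ h; first by case=> ab ba; apply: h2.
Qed.

(** The potential is a step of height [2 * A] between [u] and [v]: besides the edge itself only
    chords can cross it, and they weigh at least [A * (A - 2) >= 2 * A]. *)
Lemma unit_detour w : v = u.+1 :> nat -> path e u w -> last u w = v ->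
  2 * A <= wlen W u w.
Proof.
move=> vE uw wv; have := @detour_potential (fun z => (u < z) * (2 * A)) 1 w.
rewrite ltnn vE leqnn mul0n !mul1n add0n; apply=> // a b ab nab; rewrite !mul1n.
suff : (u < a) = (u < b) \/ 2 * A <= line_wt A a b.
  by case=> [->|]; [rewrite leq_addr|case: (u < a); case: (u < b); lia].
case: (line_edgeP A_ge4 ab) => [[bE _]|[i [g [c [_ ->]]]]]; last first.
  right; have := expE_gt0 A_ge4 i; have : A * 2 <= A * (A - 2) by rewrite leq_mul2l; lia.
  move=> h1 h2; apply: leq_trans (leq_pmull _ h2); lia.
left; rewrite bE ltnS [u <= a]leq_eqVlt; case: eqP => [ua|//]; case: nab.
by split; apply: val_inj; [rewrite /= -ua|rewrite /= bE vE ua].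
Qed.

(* Taking a neighbouring parallel chord costs two child cells, and avoiding the
   chords of this level costs [A] child cells. *)
Definition detour_height s p z : nat :=
  if z <= p then minn s (p - z)
  else if z <= p + A * s then z - p else A * s - minn s (z - (p + A * s)).

(** The height rises by [A * K ^ i] from [u] to [v]. Lower chords obey [chord_rate], a higher chord
    is heavy enough for the whole rise, and a parallel chord gains at most [(A - 2) * K ^ i], being
    shifted by at least [K ^ i] at both ends. *)
Lemma chord_detour i w : chord A m N i u -> v = u + A * K ^ i :> nat ->
  path e u w -> last u w = v -> A * (A * E ^ i) <= wlen W u w.
Proof.
move=> /(chordP m N A_ge4)[j [c [im uE cA jN]]] vE uw wv.
have X0 := expK_gt0 A_ge4 i.
have := @detour_potential (fun z => A * E ^ i * detour_height (K ^ i) u z) (K ^ i) w.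
have -> : detour_height (K ^ i) u u = 0 by rewrite /detour_height leqnn subnn minn0.
have -> : detour_height (K ^ i) u v = A * K ^ i.
  rewrite /detour_height vE leqnn addKn ifF //; apply/negbTE.
  by rewrite -ltnNge -[X in X < _]addn0 ltn_add2l muln_gt0 X0; lia.
rewrite muln0 add0n => h.
suff : A * E ^ i * (A * K ^ i) <= K ^ i * wlen W u w.
  by rewrite mulnCA mulnC -mulnA mulnC -mulnA leq_pmul2l // mulnC -mulnA mulnCA.
apply: h => // a b ab nab; have alb := line_edge_lt A_ge4 ab.
set f := detour_height (K ^ i) u.
have B4 : 4 * K ^ i <= A * K ^ i by rewrite leq_mul2r A_ge4 orbT.
suff [x [fba fab xW]] : exists x, [/\ f b <= f a + x, f a <= f b + x
    & A * E ^ i * x <= K ^ i * line_wt A a b].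
  by split; apply: leq_trans (leq_add (leqnn _) xW); rewrite -mulnDr leq_mul2l ?fba ?fab orbT.
case: (line_edgeP A_ge4 ab) => [[bE wE]|[i' [j' [c' [[_ aE bE cA' _] wE]]]]].
  exists 1; rewrite wE muln1 [K ^ i * _]mulnC leq_mul2l expE_leK // orbT.
  rewrite /f /detour_height bE; split=> //; move: B4 X0; generalize (A * K ^ i); generalize (K ^ i); clear; intros; do ?case: ifP; lia.
have [ii|ii|ii] := ltngtP i' i.
- exists (A * K ^ i'); rewrite wE; split; last exact: chord_rate.
    rewrite /f /detour_height bE; move: B4 X0; generalize (A * K ^ i'); generalize (A * K ^ i); generalize (K ^ i); clear; intros; do ?case: ifP; lia.
  rewrite /f /detour_height bE; move: B4 X0; generalize (A * K ^ i'); generalize (A * K ^ i); generalize (K ^ i); clear; intros; do ?case: ifP; lia.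
- exists (A * K ^ i).
  have fA z : f z <= A * K ^ i.
    rewrite /f /detour_height; move: B4 X0; generalize (A * K ^ i); generalize (K ^ i); clear; intros; do ?case: ifP; lia.
  split; [by rewrite (leq_trans (fA _)) ?leq_addl..|].
  have -> : A * E ^ i * (A * K ^ i) = K ^ i * (A * (A * E ^ i)) by ring.
  rewrite wE leq_mul2l; apply/orP; right.
  apply: leq_trans (chord_heavy _ _ ii) => //.
  have -> : A * E ^ i.+1 = E * (A * E ^ i) by rewrite expnS; ring.
  rewrite leq_mul2r; apply/orP; right; move: A_ge4; clear; lia.
rewrite ii in aE bE wE.
have au : a + K ^ i <= u \/ u + K ^ i <= a.
  have [lt|gt|eq] := ltngtP (j' * K + c') (j * K + c).
  - by left; rewrite aE uE -mulSnr leq_mul2r lt orbT.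
  - by right; rewrite aE uE -mulSnr leq_mul2r gt orbT.
  case: nab; rewrite eq -uE in aE.
  by split; apply: val_inj => //=; rewrite bE aE vE.
have au2 : a + A * K ^ i + K ^ i <= u + A * K ^ i \/ u + A * K ^ i + K ^ i <= a + A * K ^ i.
  by move: au; clear; lia.
exists ((A - 2) * K ^ i); split; last first.
  rewrite wE; have -> : A * E ^ i * ((A - 2) * K ^ i) = K ^ i * (E ^ i * (A * (A - 2))) by ring.
  by rewrite !leq_mul2l leq_addr !orbT.
all: rewrite mulnBl /f /detour_height bE.
all: move: B4 X0 au; generalize (A * K ^ i); generalize (K ^ i); clear; intros; do ?case: ifP; lia.
Qed.

End Detours.

(** * Running times *)

Section Runs.
Variable R : realType.
Implicit Types (s : state R) (c : cmd) (Q : state R -> Prop).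

Definition halts c (B : nat) s Q : Prop :=
  exists m s', [/\ exec c s m s', (m <= B)%N & Q s'].

Lemma halts_sub c B B' s Q Q' : halts c B s Q -> (B <= B')%N ->
  (forall s', Q s' -> Q' s') -> halts c B' s Q'.
Proof.
move=> [m [s' [h mB q]]] BB QQ; exists m, s'; split=> //; last exact: QQ.
exact: leq_trans BB.
Qed.

Lemma halts_skip s Q : Q s -> halts Skip 1 s Q.
Proof. by move=> q; exists 1%N, s; split=> //; constructor. Qed.

Lemma halts_nassign a i j e s Q :
  Q (State (upd (nmem s) a (neval s i) (neval s j) (neval s e)) (rmem s)) ->
  halts (NAssign a i j e) 1 s Q.
Proof. by move=> q; eexists 1%N, _; split=> //; [constructor|]. Qed.

Lemma halts_rassign a i j e s Q :
  Q (State (nmem s) (upd (rmem s) a (neval s i) (neval s j) (reval s e))) ->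
  halts (RAssign a i j e) 1 s Q.
Proof. by move=> q; eexists 1%N, _; split=> //; [constructor|]. Qed.

Lemma halts_seq c1 c2 B1 B2 s Q :
  halts c1 B1 s (fun s1 => halts c2 B2 s1 Q) -> halts (Seq c1 c2) (B1 + B2) s Q.
Proof.
move=> [m1 [s1 [h1 mB1 [m2 [s2 [h2 mB2 q]]]]]]; exists (m1 + m2)%N, s2.
by split=> //; [exact: exec_seq h1 h2|exact: leq_add].
Qed.

Lemma halts_if b c1 c2 B s Q :
  (beval s b -> halts c1 B s Q) -> (~~ beval s b -> halts c2 B s Q) ->
  halts (If b c1 c2) B.+1 s Q.
Proof.
move=> h1 h2; have [m [s' [h mB q]]] : halts (if beval s b then c1 else c2) B s Q.
  by case: ifP => [/h1//|/negbT/h2].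
by exists m.+1, s'; split=> //; constructor.
Qed.

(** Natural array 4 is reserved for loop counters, one cell per nesting depth. *)
Definition loop_var (r : nat) : nexp := NCell 4 (NConst r) (NConst 0).

Definition for_loop (r : nat) (body : cmd) : cmd :=
  Seq (NAssign 4 (NConst r) (NConst 0) (NConst 0))
    (While (BNot (BLeN (NCell 0 (NConst 0) (NConst 0)) (loop_var r)))
      (Seq body
        (NAssign 4 (NConst r) (NConst 0) (NAdd (loop_var r) (NConst 1))))).

Definition set_loop_var (r v : nat) s : state R :=
  State (upd (nmem s) 4 r 0 v) (rmem s).

Lemma halts_for r body B n (Inv : nat -> state R -> Prop) s :
  (forall i s, Inv i s -> nmem s 0 0 0 = n) ->
  (forall i v s, Inv i s -> Inv i (set_loop_var r v s)) ->
  (forall i s, (i < n)%N -> Inv i s -> nmem s 4 r 0 = i ->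
    halts body B s (fun s' => Inv i.+1 s' /\ nmem s' 4 r 0 = i)) ->
  Inv 0%N s -> halts (for_loop r body) ((B + 2) * n + 2) s (Inv n).
Proof.
move=> getn stable hbody inv0.
(* One step initialises the counter and one evaluates the failing test; each round adds a test and
   an increment to the body. *)
have -> : ((B + 2) * n + 2 = 1 + ((B + 2) * n + 1))%N by lia.
apply: halts_seq; apply: halts_nassign.
set loop := While _ _.
suff h k s1 : (k <= n)%N -> nmem s1 4 r 0 = (n - k)%N -> Inv (n - k)%N s1 ->
    halts loop ((B + 2) * k + 1) s1 (Inv n).
  apply: h; rewrite ?subnn //; first by rewrite /= /upd !eqxx.
  exact: stable inv0.
elim: k s1 => [|k IH] s1 kn v1 inv1.
  rewrite muln0 add0n subn0 in v1 inv1 *.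
  exists 1%N, s1; split=> //; apply: exec_while_false.
  by rewrite /= negbK (getn _ _ inv1) v1 leqnn.
have ltn : (n - k.+1 < n)%N by lia.
have [m [s2 [h2 mB [inv2 v2]]]] := hbody _ _ ltn inv1 v1.
set s3 := set_loop_var r (n - k) s2.
have skn : (n - k.+1).+1 = (n - k)%N by lia.
have v3 : nmem s3 4 r 0 = (n - k)%N by rewrite /= /upd !eqxx.
have inv3 : Inv (n - k)%N s3 by apply: stable; rewrite -skn.
have [m' [s' [h' mB' q]]] := IH s3 (ltnW kn) v3 inv3.
exists (m + 1 + m').+1, s'; split=> //; last by lia.
apply: exec_while_true h'; first by rewrite /= (getn _ _ inv1) v1 -ltnNge; lia.
apply: exec_seq h2 _.
have -> : s3 = State (upd (nmem s2) 4 (neval s2 (NConst r)) (neval s2 (NConst 0))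
    (neval s2 (NAdd (loop_var r) (NConst 1)))) (rmem s2).
  by rewrite /= v2 addn1 skn.
constructor.
Qed.

(** What code at nesting depth [r] must preserve: the input arrays 0 to 2 and the counters of the
    enclosing loops. *)
Definition frame (r : nat) s s' : Prop :=
  [/\ forall a i j, (a <= 2)%N -> nmem s' a i j = nmem s a i j,
      forall k, (k < r)%N -> nmem s' 4 k 0 = nmem s 4 k 0
    & forall a i j, (a <= 2)%N -> rmem s' a i j = rmem s a i j].

Lemma frame_refl r s : frame r s s. Proof. by split. Qed.

Lemma frame_trans r s1 s2 s3 : frame r s1 s2 -> frame r s2 s3 -> frame r s1 s3.
Proof.
move=> [a1 b1 c1] [a2 b2 c2]; split=> [a i j ha|k hk|a i j ha].
- by rewrite a2 // a1.
- by rewrite b2 // b1.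
- by rewrite c2 // c1.
Qed.

Lemma frame_le r r' s s' : (r <= r')%N -> frame r' s s' -> frame r s s'.
Proof. by move=> rr [a b c]; split=> // k kr; apply: b; apply: leq_trans rr. Qed.

Lemma frame_set_loop_var r v s : frame r s (set_loop_var r v s).
Proof.
split=> //= [a i j ha|k kr]; rewrite /upd; first by case: eqP ha => // ->.
by rewrite eqxx (ltn_eqF kr).
Qed.

Lemma frame_rassign r a i j x s : (2 < a)%N ->
  frame r s (State (nmem s) (upd (rmem s) a i j x)).
Proof.
move=> a2; split=> //= b i' j' b2; rewrite /upd ifF //.
by apply/negbTE; rewrite negb_and neq_ltn (leq_ltn_trans b2 a2).
Qed.

Lemma frame_nassign r a i j x s : (2 < a)%N -> a != 4%N ->
  frame r s (State (upd (nmem s) a i j x) (rmem s)).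
Proof.
move=> a2 a4; split=> //= [b i' j' b2|k kr]; rewrite /upd ifF //.
  by apply/negbTE; rewrite negb_and neq_ltn (leq_ltn_trans b2 a2).
by rewrite eq_sym (negbTE a4).
Qed.

(** The preorder [Rel] expresses monotone progress: a fact [P i] obtained in round [i] survives the
    later rounds, which lets nested loops compose. *)
Lemma halts_forall r body B n (Rel : state R -> state R -> Prop)
    (P : nat -> state R -> Prop) s0 :
  (forall s v, Rel s (set_loop_var r v s)) -> (forall s, Rel s s) ->
  (forall s1 s2 s3, Rel s1 s2 -> Rel s2 s3 -> Rel s1 s3) ->
  (forall i s s', Rel s s' -> P i s -> P i s') ->
  nmem s0 0 0 0 = n ->
  (forall i s, (i < n)%N -> frame r s0 s -> Rel s0 s -> nmem s 4 r 0 = i ->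
    halts body B s (fun s' => [/\ frame r.+1 s s', Rel s s' & P i s'])) ->
  halts (for_loop r body) ((B + 2) * n + 2) s0
    (fun s' => [/\ frame r s0 s', Rel s0 s' & forall i, (i < n)%N -> P i s']).
Proof.
move=> Rset Rrefl Rtr PR s0n hbody.
apply: (@halts_for _ _ _ n (fun k s' =>
  [/\ frame r s0 s', Rel s0 s' & forall i, (i < k)%N -> P i s'])).
- by move=> i s [[h _ _] _ _]; rewrite h.
- move=> i v s [h1 h2 h3]; split=> [||k ki].
  + exact: frame_trans h1 (frame_set_loop_var _ _ _).
  + exact: Rtr h2 (Rset _ _).
  + by apply: PR (h3 _ ki).
- move=> i s iltn [h1 h2 h3] iv.
  apply: halts_sub (hbody i s iltn h1 h2 iv) (leqnn _) _ => s' [f1 f2 f3].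
  split; last by case: f1 => _ -> //; rewrite ltnS.
  split=> [||k].
  + exact: frame_trans h1 (frame_le (leqnSn _) f1).
  + exact: Rtr h2 f2.
  + by rewrite ltnS leq_eqVlt => /orP[/eqP->//|ki]; apply: PR f2 (h3 _ ki).
- by split=> //; exact: frame_refl.
Qed.

End Runs.

(** * The program *)

Section OracleProgram.
Local Notation v0 := (loop_var 0).
Local Notation v1 := (loop_var 1).
Local Notation v2 := (loop_var 2).
Local Notation v3 := (loop_var 3).
Local Notation dcell a b := (RCell 3 a b).

(* Cell (0, 0) of real array 4 is raised to [n] times the weight of the edge
   {0, 1}, which stands for infinity in the graphs considered here. *)
Definition bound_prog : cmd :=
  for_loop 0 (RAssign 4 (NConst 0) (NConst 0)
    (RAdd (RCell 4 (NConst 0) (NConst 0)) (RCell 0 (NConst 0) (NConst 1)))).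

Definition init_prog : cmd :=
  for_loop 0 (for_loop 1 (If (BAnd (BLeN v0 v1) (BLeN v1 v0))
    (RAssign 3 v0 v1 (RConst 0))
    (RAssign 3 v0 v1 (RCell 4 (NConst 0) (NConst 0))))).

Definition relax_step : cmd :=
  If (BAnd (BLeN (NConst 1) (NCell 1 v1 v3))
           (BLeR (RAdd (RCell 0 v1 v3) (dcell v3 v2)) (dcell v1 v2)))
    (RAssign 3 v1 v2 (RAdd (RCell 0 v1 v3) (dcell v3 v2))) Skip.

Definition relax_round : cmd := for_loop 1 (for_loop 2 (for_loop 3 relax_step)).

Definition relax_prog : cmd := for_loop 0 relax_round.

Definition collect_test : bexp :=
  let d := dcell v2 v3 in
  let L := RCell 1 (NConst 0) (NConst 0) in
  BAnd (BLeN (NConst 1) (NCell 1 v0 v1))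
  (BAnd (BLeN (NConst 1) (NCell 2 v2 (NConst 0)))
  (BAnd (BLeN (NConst 1) (NCell 2 v3 (NConst 0)))
  (BAnd (BLeR L d) (BAnd (BNot (BLeR (RMul (RConst 2) L) d))
    (BLeR (RAdd (RAdd (dcell v2 v0) (RCell 0 v0 v1)) (dcell v1 v3)) d))))).

Definition collect_prog : cmd :=
  for_loop 0 (for_loop 1 (for_loop 2 (for_loop 3
    (If collect_test (NAssign 3 v0 v1 (NConst 1)) Skip)))).

Definition oracle_prog : cmd :=
  Seq bound_prog (Seq init_prog (Seq relax_prog collect_prog)).

Variables (R : realType) (n : nat) (w : nat -> nat -> R).
Variables (adjn : nat -> nat -> bool) (inT : nat -> bool) (L : R).
Variable delta : nat -> nat -> R.

Fixpoint rlen (i : nat) (p : seq nat) : R :=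
  if p is k :: p' then w i k + rlen k p' else 0.

Definition reaches i j p :=
  [/\ path adjn i p, all (fun k => k < n)%N p & last i p = j].

(** What Bellman-Ford asks of the distances: the initial entries are upper bounds, relaxation never
    undershoots, and each distance is attained by a walk of at most [n] edges. *)
Hypothesis delta_le : forall i j, (i < n)%N -> (j < n)%N -> delta i j <= n%:R * w 0 1.
Hypothesis deltaii : forall i, (i < n)%N -> delta i i = 0.
Hypothesis delta_step : forall i k j, (i < n)%N -> (k < n)%N -> (j < n)%N ->
  adjn i k -> delta i j <= w i k + delta k j.
Hypothesis delta_att : forall i j, (i < n)%N -> (j < n)%N ->
  exists p, [/\ reaches i j p, (size p <= n)%N & rlen i p = delta i j].

Record holds_input (s : state R) : Prop := HoldsInput {
  in_size : nmem s 0 0 0 = n;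
  in_adj : forall i j, nmem s 1 i j = adjn i j;
  in_T : forall i, nmem s 2 i 0 = inT i;
  in_w : forall i j, rmem s 0 i j = w i j;
  in_L : rmem s 1 0 0 = L }.

Lemma frame_input r s s' : frame r s s' -> holds_input s -> holds_input s'.
Proof.
move=> [h1 _ h3] [a b c d e]; split=> [|i j|i|i j|]; rewrite ?h1 ?h3 //.
Qed.

(** Expressions cannot turn a natural number into a real, so multiplication by [n] is repeated
    addition. *)
Lemma bound_progP s : holds_input s -> rmem s 4 0 0 = 0 ->
  halts bound_prog (3 * n + 2) s (fun s' =>
    [/\ frame 0 s s', rmem s' 4 0 0 = n%:R * w 0 1 & nmem s' 3 = nmem s 3]).
Proof.
move=> inp r0; apply: (@halts_for _ _ _ 1 n (fun k s' =>
  [/\ frame 0 s s', rmem s' 4 0 0 = k%:R * w 0 1 & nmem s' 3 = nmem s 3])).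
- by move=> i s' [f _ _]; exact: in_size (frame_input f inp).
- move=> i v s' [f1 f2 f3]; split=> //.
  exact: frame_trans f1 (frame_set_loop_var _ _ _).
- move=> i s' _ [f1 f2 f3] iv; apply: halts_rassign; split=> //; split=> //.
    by apply: frame_trans f1 (frame_rassign _ _ _ _ _ _).
  by rewrite /= /upd !eqxx /= f2 (in_w (frame_input f1 inp)) -natr1 mulrDl mul1r.
- by split=> //; rewrite r0 mul0r.
Qed.

Definition keep_output (s s' : state R) : Prop := nmem s' 3 = nmem s 3.

Lemma init_progP s : holds_input s -> rmem s 4 0 0 = n%:R * w 0 1 ->
  halts init_prog ((((2 + 2) * n + 2) + 2) * n + 2) s (fun s' =>
    [/\ frame 0 s s', nmem s' 3 = nmem s 3
      & forall i j, (i < n)%N -> (j < n)%N ->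
        rmem s' 3 i j = if i == j then 0 else n%:R * w 0 1]).
Proof.
move=> inp r4.
pose goal i j (s' : state R) := rmem s' 3 i j = if i == j then 0 else n%:R * w 0 1.
pose Rel s s' := [/\ keep_output s s', rmem s' 4 0 0 = rmem s 4 0 0
  & forall i j, goal i j s -> goal i j s'].
have Rset r s1 v : Rel s1 (set_loop_var r v s1) by [].
have Rrefl s1 : Rel s1 s1 by [].
have Rtr s1 s2 s3 : Rel s1 s2 -> Rel s2 s3 -> Rel s1 s3.
  move=> [a1 b1 c1] [a2 b2 c2]; split; [exact: etrans a1|exact: etrans b1|].
  by move=> i j /c1/c2.
have body i s1 : (i < n)%N -> frame 0 s s1 -> Rel s s1 -> nmem s1 4 0 0 = i ->
    halts (for_loop 1 (If (BAnd (BLeN v0 v1) (BLeN v1 v0))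
    (RAssign 3 v0 v1 (RConst 0))
    (RAssign 3 v0 v1 (RCell 4 (NConst 0) (NConst 0))))) ((2 + 2) * n + 2) s1
    (fun s' => [/\ frame 1 s1 s', Rel s1 s' & forall j, (j < n)%N -> goal i j s']).
  move=> ilt f1 r1 iv.
  apply: (@halts_forall _ _ _ _ _ Rel (fun j => goal i j)) => //.
  - by move=> j a b [_ _ h]; apply: h.
  - exact: in_size (frame_input f1 inp).
  move=> j s2 jlt f2 r2 jv; have iv2 : nmem s2 4 0 0 = i.
    by case: f2 => _ -> //.
  have leaf x : x = (if i == j then 0 else n%:R * w 0 1) ->
     [/\ frame 2 s2 (State (nmem s2) (upd (rmem s2) 3 i j x)),
       Rel s2 (State (nmem s2) (upd (rmem s2) 3 i j x))
       & goal i j (State (nmem s2) (upd (rmem s2) 3 i j x))].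
    move=> xE; have gij : goal i j (State (nmem s2) (upd (rmem s2) 3 i j x)).
      by rewrite /goal /= /upd !eqxx.
    split=> //; first exact: frame_rassign.
    split=> // i' j'; case: (eqVneq i' i) => [->|ne]; last first.
      by rewrite /goal /= /upd /= (negbTE ne).
    case: (eqVneq j' j) => [-> //|ne].
    by rewrite /goal /= /upd /= (negbTE ne) andbF.
  apply: halts_if; rewrite /= iv2 jv -eqn_leq => ij.
    by apply: halts_rassign; rewrite /= iv2 jv; apply: leaf; rewrite ij.
  apply: halts_rassign; rewrite /= iv2 jv; apply: leaf; rewrite (negbTE ij).
  by case: r1 => _ h _; case: r2 => _ h' _; rewrite h' h.
have := @halts_forall _ 0 _ _ n Rel
  (fun i s' => forall j, (j < n)%N -> goal i j s') s (Rset 0%N) Rrefl Rtr _ (in_size inp) body.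
move=> h; apply: halts_sub (h _) (leqnn _) _.
  by move=> i a b [_ _ ab] ga j /ga/ab.
by move=> s' [f [k _ _] g]; split=> // i j ilt jlt; apply: g.
Qed.

(** * Bellman-Ford relaxation *)

Definition sound (s : state R) : Prop :=
  forall i j, (i < n)%N -> (j < n)%N -> delta i j <= rmem s 3 i j.

Definition improves (s s' : state R) : Prop :=
  [/\ keep_output s s',
      forall i j, (i < n)%N -> (j < n)%N -> rmem s' 3 i j <= rmem s 3 i j
    & sound s -> sound s'].

Lemma improves_refl s : improves s s. Proof. by split. Qed.
Lemma improves_set_loop_var r s v : improves s (set_loop_var r v s).
Proof. by split. Qed.
Lemma improves_trans s1 s2 s3 : improves s1 s2 -> improves s2 s3 -> improves s1 s3.
Proof.
move=> [a1 b1 c1] [a2 b2 c2]; split; [exact: etrans a1| |by move=> /c1/c2].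
by move=> i j il jl; apply: le_trans (b2 _ _ il jl) (b1 _ _ il jl).
Qed.

(** The comparison is with the table at the start of the round: updates are made in place, but
    entries only decrease, so values read later are at least as good. *)
Lemma relax_roundP s : holds_input s -> sound s ->
  halts relax_round ((((((2 + 2) * n + 2) + 2) * n + 2) + 2) * n + 2) s (fun s' =>
    [/\ frame 1 s s', improves s s'
      & forall i j k, (i < n)%N -> (j < n)%N -> (k < n)%N -> adjn i k ->
        rmem s' 3 i j <= w i k + rmem s 3 k j]).
Proof.
move=> inp snd.
pose goal i j k (s' : state R) := adjn i k -> rmem s' 3 i j <= w i k + rmem s 3 k j.
have mono i j k s1 s2 : (i < n)%N -> (j < n)%N -> improves s1 s2 -> goal i j k s1 -> goal i j k s2.
  by move=> il jl [_ h _] g a; apply: le_trans (h _ _ il jl) (g a).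
have leaf i j k s3 : (i < n)%N -> (j < n)%N -> (k < n)%N -> frame 1 s s3 -> improves s s3 ->
   nmem s3 4 1 0 = i -> nmem s3 4 2 0 = j -> nmem s3 4 3 0 = k ->
   halts relax_step 2 s3 (fun s' => [/\ frame 4 s3 s', improves s3 s' & goal i j k s']).
  move=> il jl kl f im iv jv kv; have inp3 := frame_input f inp.
  have snd3 : sound s3 by case: im => _ _; apply.
  have imp k' : (k' < n)%N -> rmem s3 3 k' j <= rmem s 3 k' j by case: im => _ h _ kl'; apply: h.
  apply: halts_if; rewrite /= iv jv kv (in_adj inp3) (in_w inp3) lt0b.
    move=> /andP[ik le]; apply: halts_rassign; rewrite /= iv jv kv (in_w inp3).
    split; first exact: frame_rassign.
      split=> // [i' j' il' jl'|_ i' j' il' jl']; rewrite /= /upd /=.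
        by case: ifP => // /andP[/eqP-> /eqP->].
      case: ifP => [/andP[/eqP-> /eqP->]|_]; last exact: snd3.
      apply: le_trans (delta_step il kl jl ik) _.
      by rewrite lerD2l; apply: snd3.
    by move=> _; rewrite /= /upd !eqxx /= lerD2l; apply: imp.
  move=> nle; apply: halts_skip; split; [exact: frame_refl|exact: improves_refl|].
  move=> ik; move: nle; rewrite ik /= -ltNge => /ltW le.
  by apply: le_trans le _; rewrite lerD2l; apply: imp.
have size0 r s1 : frame r s s1 -> nmem s1 0 0 0 = n.
  by move=> f; exact: in_size (frame_input f inp).
have var r k (s1 s2 : state R) : (k < r)%N -> frame r s1 s2 -> nmem s2 4 k 0 = nmem s1 4 k 0.
  by move=> kr [_ h _]; apply: h.
apply: halts_sub _ (leqnn _) _.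
  apply: (@halts_forall _ 1 _ _ n improves (fun i s' => (i < n)%N -> forall j, (j < n)%N ->
     forall k, (k < n)%N -> goal i j k s') s (@improves_set_loop_var 1) improves_refl improves_trans).
  - by move=> i a b ab g il j jl k kl; apply: mono (g _ _ _ _ _).
  - exact: in_size inp.
  move=> i s1 il f1 r1 iv.
  apply: halts_sub _ (leqnn _) _.
    apply: (@halts_forall _ 2 _ _ n improves (fun j s' => (j < n)%N ->
       forall k, (k < n)%N -> goal i j k s') s1 (@improves_set_loop_var 2) improves_refl improves_trans).
    - by move=> j a b ab g jl k kl; apply: mono (g _ _ _).
    - exact: size0 f1.
    move=> j s2 jl f2 r2 jv.
    have f02 := frame_trans f1 (frame_le (leqnSn _) f2).
    apply: halts_sub _ (leqnn _) _.
      apply: (@halts_forall _ 3 _ _ n improves (fun k s' => goal i j k s') s2 (@improves_set_loop_var 3) improves_refl improves_trans).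
      - by move=> k a b ab g; apply: mono g.
      - exact: size0 f02.
      move=> k s3 kl f3 r3 kv; apply: leaf => //.
      + exact: frame_trans f02 (frame_le _ f3).
      + exact: improves_trans r1 (improves_trans r2 r3).
      + by rewrite (var 3 1 s2)%N // (var 2 1 s1)%N.
      + by rewrite (var 3 2 s2)%N.
    by move=> s' [a b c]; split=> // _ k; apply: c.
  by move=> s' [a b c]; split=> // _ j jl; apply: c.
by move=> s' [a b c]; split=> // i j k il jl; apply: c.
Qed.

(** After [r] rounds each entry is at most the length of every walk of at most [r] edges, and never
    below the distance; [n] rounds suffice by [delta_att]. *)
Lemma relax_progP s : holds_input s ->
  (forall i j, (i < n)%N -> (j < n)%N ->
     rmem s 3 i j = if i == j then 0 else n%:R * w 0 1) ->
  halts relax_prog (((((((2 + 2) * n + 2) + 2) * n + 2) + 2) * n + 2 + 2) * n + 2) s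
    (fun s' => [/\ frame 0 s s', nmem s' 3 = nmem s 3
      & forall i j, (i < n)%N -> (j < n)%N -> rmem s' 3 i j = delta i j]).
Proof.
move=> inp ini.
have snd : sound s.
  by move=> i j il jl; rewrite ini //; case: eqP => [->|_]; [rewrite deltaii|exact: delta_le].
pose bnd r (s' : state R) := forall i j p, (i < n)%N -> reaches i j p -> (size p <= r)%N ->
  rmem s' 3 i j <= rlen i p.
have lastlt i j p : (i < n)%N -> reaches i j p -> (j < n)%N.
  by move=> il [_ ap <-]; elim: p i il ap => //= k p IH i il /andP[kl /IH]; apply.
apply: halts_sub _ (leqnn _) _.
  apply: (@halts_for _ _ _ _ n (fun r s' => [/\ frame 0 s s', improves s s' & bnd r s'])).
  - by move=> i s' [f _ _]; exact: in_size (frame_input f inp).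
  - move=> i v s' [f im b]; split=> //.
    exact: frame_trans f (frame_set_loop_var _ _ _).
  - move=> r s1 rl [f1 im1 b1] rv.
    have snd1 : sound s1 by case: im1 => _ _; apply.
    apply: halts_sub (relax_roundP (frame_input f1 inp) snd1) (leqnn _) _.
    move=> s' [f2 im2 g]; split; last by case: f2 => _ -> .
    split; [exact: frame_trans f1 (frame_le _ f2)|exact: improves_trans im1 im2|].
    move=> i j p il rp sz; have jl := lastlt _ _ _ il rp.
    case: p rp sz => [|k p] rp sz.
      have [_ _ /= ij] := rp; case: im2 => _ h _; apply: le_trans (h _ _ il jl) _.
      exact: (b1 i j [::] il rp).
    have [/= /andP[ik kp] /andP[kl pl] pj] := rp.
    apply: le_trans (g i j k il jl kl ik) _; rewrite /= lerD2l; apply: b1 => //.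
  - split; [exact: frame_refl|exact: improves_refl|].
    move=> i j [|//] il rp _; have jl := lastlt _ _ _ il rp.
    by case: rp => _ _ /= ij; rewrite ini // ij eqxx.
move=> s' [f [k _ snd'] b]; split=> // i j il jl; apply/le_anti/andP; split; last exact: snd'.
have [p [rp sz <-]] := delta_att il jl.
exact: b.
Qed.

Definition collected u v : Prop :=
  [/\ (u < n)%N, (v < n)%N, adjn u v &
    exists x y, [/\ (x < n)%N, (y < n)%N &
      [&& inT x, inT y, L <= delta x y, delta x y < 2 * L
        & delta x u + w u v + delta v y <= delta x y]]].

Lemma collect_progP s : holds_input s -> (forall u v, nmem s 3 u v = 0%N) ->
  (forall i j, (i < n)%N -> (j < n)%N -> rmem s 3 i j = delta i j) ->
  halts collect_prog ((((((((2 + 2) * n + 2) + 2) * n + 2) + 2) * n + 2) + 2) * n + 2) s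
    (fun s' => forall u v, (u < n)%N -> (v < n)%N ->
      (nmem s' 3 u v != 0%N) <-> collected u v).
Proof.
move=> inp out0 dE.
(* [only] is soundness of the marks and [hit] their completeness; both persist because marks are
   never erased and each new one passes the test. *)
pose only (s' : state R) := forall u v, nmem s' 3 u v != 0%N -> collected u v.
pose grows s s' := [/\ rmem s' 3 = rmem s 3,
  forall u v, nmem s 3 u v != 0%N -> nmem s' 3 u v != 0%N & only s -> only s'].
have gset r s1 v : grows s1 (set_loop_var r v s1) by [].
have grefl s1 : grows s1 s1 by [].
have gtr s1 s2 s3 : grows s1 s2 -> grows s2 s3 -> grows s1 s3.
  move=> [a1 b1 c1] [a2 b2 c2]; split; [exact: etrans a1|by move=> u v /b1/b2|by move=> /c1/c2].
pose hit u v x y (s' : state R) := adjn u v ->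
  [&& inT x, inT y, L <= delta x y, delta x y < 2 * L
        & delta x u + w u v + delta v y <= delta x y] -> nmem s' 3 u v != 0%N.
have mono u v x y s1 s2 : grows s1 s2 -> hit u v x y s1 -> hit u v x y s2.
  by move=> [_ h _] g a b; apply: h; apply: g.
have leaf u v x y s4 : (u < n)%N -> (v < n)%N -> (x < n)%N -> (y < n)%N ->
   frame 0 s s4 -> grows s s4 ->
   nmem s4 4 0 0 = u -> nmem s4 4 1 0 = v -> nmem s4 4 2 0 = x -> nmem s4 4 3 0 = y ->
   halts (If collect_test (NAssign 3 v0 v1 (NConst 1)) Skip) 2 s4
     (fun s' => [/\ frame 4 s4 s', grows s4 s' & hit u v x y s']).
  move=> ul vl xl yl f g uv vv xv yv; have inp4 := frame_input f inp.
  have d4 i j : (i < n)%N -> (j < n)%N -> rmem s4 3 i j = delta i j.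
    by case: g => -> _ _; apply: dE.
  apply: halts_if; rewrite /= uv vv xv yv (in_adj inp4) !(in_T inp4) (in_w inp4) (in_L inp4)
    !d4 // !lt0b -ltNge.
    move=> /andP[auv t]; apply: halts_nassign; rewrite /= uv vv; split.
    - exact: frame_nassign.
    - split=> //= [u' v'|o u' v']; rewrite /= /upd /=; case: ifP => //.
        by move=> /andP[/eqP-> /eqP->] _; split=> //; exists x, y; split.
      by move=> _; apply: o.
    - by move=> _ _; rewrite /= /upd !eqxx.
  move=> t; apply: halts_skip; split=> //.
  by move=> a b; rewrite a b in t.
have size0 r s1 : frame r s s1 -> nmem s1 0 0 0 = n.
  by move=> f; exact: in_size (frame_input f inp).
have var r k (s1 s2 : state R) : (k < r)%N -> frame r s1 s2 -> nmem s2 4 k 0 = nmem s1 4 k 0.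
  by move=> kr [_ h _]; apply: h.
have le0 r (s1 s2 : state R) : frame r s1 s2 -> frame 0 s1 s2 by exact: frame_le.
apply: halts_sub _ (leqnn _) _.
  apply: (@halts_forall _ 0 _ _ n grows (fun u s' => forall v, (v < n)%N -> forall x, (x < n)%N ->
     forall y, (y < n)%N -> hit u v x y s')) => //.
  - by move=> u a b ab h v vl x xl y yl; apply: mono (h _ _ _ _ _ _).
  - exact: in_size inp.
  move=> u s1 ul f1 r1 uv.
  apply: (@halts_forall _ 1 _ _ n grows (fun v s' => forall x, (x < n)%N ->
     forall y, (y < n)%N -> hit u v x y s')) => //.
  - by move=> v a b ab h x xl y yl; apply: mono (h _ _ _ _).
  - exact: size0 f1.
  move=> v s2 vl f2 r2 vv; have f02 := frame_trans f1 (le0 _ _ _ f2).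
  apply: (@halts_forall _ 2 _ _ n grows (fun x s' =>
     forall y, (y < n)%N -> hit u v x y s')) => //.
  - by move=> x a b ab h y yl; apply: mono (h _ _).
  - exact: size0 f02.
  move=> x s3 xl f3 r3 xv; have f03 := frame_trans f02 (le0 _ _ _ f3).
  apply: (@halts_forall _ 3 _ _ n grows (fun y s' => hit u v x y s')) => //.
  - by move=> y a b ab; apply: mono.
  - exact: size0 f03.
  move=> y s4 yl f4 r4 yv; apply: leaf => //.
  - exact: frame_trans f03 (le0 _ _ _ f4).
  - exact: gtr r1 (gtr _ _ _ r2 (gtr _ _ _ r3 r4)).
  - by rewrite (var 3 0 s3)%N // (var 2 0 s2)%N // (var 1 0 s1)%N.
  - by rewrite (var 3 1 s3)%N // (var 2 1 s2)%N.
  - by rewrite (var 3 2 s3)%N.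
move=> s' [_ [_ _ o] h] u v ul vl; split.
  by apply: o => u' v'; rewrite out0.
by move=> [_ _ a [x [y [xl yl c]]]]; apply: (h u ul v vl x xl y yl).
Qed.

Lemma oracle_progP s : (0 < n)%N -> holds_input s ->
  (forall u v, nmem s 3 u v = 0%N) -> rmem s 4 0 0 = 0 ->
  halts oracle_prog (100 * n ^ 100) s
    (fun s' => forall u v, (u < n)%N -> (v < n)%N ->
      (nmem s' 3 u v != 0%N) <-> collected u v).
Proof.
move=> n0 inp out0 r0.
eapply halts_sub; [|  |exact: (fun _ => id)].
  apply: halts_seq; apply: halts_sub (bound_progP inp r0) (leqnn _) _ => s1 [f1 r1 o1].
  have inp1 := frame_input f1 inp.
  apply: halts_seq; apply: halts_sub (init_progP inp1 r1) (leqnn _) _ => s2 [f2 o2 d2].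
  have inp2 := frame_input f2 inp1.
  apply: halts_seq; apply: halts_sub (relax_progP inp2 d2) (leqnn _) _ => s3 [f3 o3 d3].
  have inp3 := frame_input f3 inp2.
  by apply: collect_progP => // u v; rewrite o3 o2 o1.
(* Four nested loops give degree 4; the exponent becomes 100 because one number serves as factor and
   exponent of the time bound. *)
apply: (@leq_trans (100 * n ^ 4)); last by rewrite leq_mul2l leq_pexp2l.
rewrite !expnS expn0 muln1; nia.
Qed.

End OracleProgram.

(** * The weighted graph *)

Section LineWGraph.
Variables (R : realType) (A m N n : nat).
Hypotheses (A_ge4 : (4 <= A)%N) (N_le : (N <= n)%N).
Local Notation V := 'I_n.+1.
Local Notation W := (@line_W A n).
Local Notation d := (@line_dist A m N n).

Definition pair_edge (p : V * V) : {set V} := [set p.1; p.2]%SET.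

Definition line_pairs : {set V * V} := [set p : V * V | line_edge A m N p.1 p.2]%SET.

Definition line_edges : {set {set V}} := [set pair_edge p | p in line_pairs]%SET.

(** Weights are attached to unordered edges: the larger end is recovered as the maximum, the smaller
    one as the sum minus the maximum. *)
Definition set_wt (e : {set V}) : nat :=
  let hi := (\max_(z in e) z)%N in line_wt A ((\sum_(z in e) z)%N - hi) hi.

Lemma set_wt_pair (x y : V) : x != y -> set_wt [set x; y]%SET = W x y.
Proof.
move=> xy; rewrite /set_wt /line_W !big_setU1 ?inE //= !big_set1 -/(maxn x y).
by congr (line_wt _ _ _); rewrite /maxn /minn; case: ltnP; rewrite ?addnK // addKn.
Qed.

Lemma pair_edge_inj : {in line_pairs &, injective pair_edge}.
Proof.
move=> [a b] [x y]; rewrite !inE /= => ab xy /setP e.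
have := line_edge_lt A_ge4 ab; have := line_edge_lt A_ge4 xy => h1 h2.
have := e a; have := e b; have := e x; have := e y; rewrite !inE !eqxx ?orbT /=.
move=> /orP[]/eqP ? /orP[]/eqP ? /esym/orP[]/eqP ? /esym/orP[]/eqP ?; subst => //; lia.
Qed.

Lemma adj_line : adj line_edges =2 @line_adj A m N n.
Proof.
move=> x y; rewrite /adj; apply/imsetP/idP => [[[a b]]|].
  rewrite inE /= => ab /setP e; have := line_edge_lt A_ge4 ab => h.
  have := e a; have := e b; have := e x; have := e y; rewrite !inE !eqxx ?orbT /=.
  rewrite /line_adj.
  move=> /esym/orP[]/eqP ? /esym/orP[]/eqP ? /orP[]/eqP ? /orP[]/eqP ?; subst => //;
    by rewrite ?ab ?orbT //; lia.
case/orP=> h; [exists (x, y)|exists (y, x)]; rewrite ?inE //.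
by rewrite /pair_edge /= finset.setUC.
Qed.

Lemma line_edges_pair e : e \in line_edges ->
  exists x y : V, [/\ line_edge A m N x y, x != y & e = [set x; y]%SET].
Proof.
case/imsetP=> [[x y]]; rewrite inE /= => xy ->; exists x, y; split=> //.
by apply/eqP => h; have := line_edge_lt A_ge4 xy; rewrite h ltnn.
Qed.

Lemma line_edges_card2 e : e \in line_edges -> #|e| = 2%N.
Proof. by case/line_edges_pair => x [y [_ xy ->]]; rewrite cards2 xy. Qed.

Lemma line_edges_wt_gt0 e : e \in line_edges -> 0 < (set_wt e)%:R :> R.
Proof.
case/line_edges_pair => x [y [h xy ->]].
by rewrite ltr0n set_wt_pair // line_W_lt ?(line_edge_lt A_ge4 h) // (line_wt_gt0 A_ge4 h).
Qed.

Definition line_graph : wgraph R n.+1 :=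
  WGraph line_edges_card2 line_edges_wt_gt0.

Lemma line_adj_neq (x y : V) : line_adj A m N x y -> x != y.
Proof.
by move=> h; apply/eqP => xy; move: h; rewrite xy /line_adj orbb => /(line_edge_lt A_ge4); rewrite ltnn.
Qed.

Lemma walk_length_line x p : path (@line_adj A m N n) x p ->
  walk_length line_graph x p = (wlen W x p)%:R.
Proof.
rewrite /walk_length; elim: p x => [|y p IH] x /=; first by rewrite big_nil.
case/andP=> xy /IH; rewrite big_cons natrD => ->.
by rewrite set_wt_pair // line_adj_neq.
Qed.

Lemma dist_line_le F x p k : path (adj F) x p -> path (@line_adj A m N n) x p ->
  (wlen W x p <= k)%N -> (dist line_graph F x (last x p) <= k%:R%:E)%E.
Proof.
move=> Fp lp pk; apply: ge_ereal_inf; exists (walk_length line_graph x p)%:E; first by exists p.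
by rewrite lee_fin walk_length_line // ler_nat.
Qed.

Lemma dist_line_ge (F : {set {set V}}) x y k : F \subset line_edges ->
  (forall p, path (adj F) x p -> last x p = y -> (k <= wlen W x p)%N) ->
  (k%:R%:E <= dist line_graph F x y)%E.
Proof.
move=> FE h; apply/ereal_infP => _ [p [Fp py ->]].
rewrite lee_fin walk_length_line ?ler_nat; first exact: h.
apply: sub_path Fp => a b; rewrite -adj_line; exact: (fintype.subsetP FE).
Qed.

Lemma dist_graph_line x y : dist_graph line_graph x y = (d x y)%:R%:E.
Proof.
have pE u q : path (adj line_edges) u q = path (@line_adj A m N n) u q.
  exact: (eq_path adj_line).
apply/le_anti/andP; split; last first.
  apply: dist_line_ge => // p; rewrite pE => xp <-; exact: sdist_min.
have [p [xp <- pl]] := sdist_walk W (@line_connected A m N n) x y.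
by apply: dist_line_le; rewrite ?pE // pl.
Qed.

Lemma line_graph_connected : connected_graph (edges line_graph).
Proof.
by move=> x y; rewrite (eq_connect adj_line); exact: line_connected.
Qed.

(** Avoiding an edge costs a factor of at least 2 for unit edges and more than [1 + 1 / A] for
    chords. With [m = 0] there are no chords and [eps < 1] is enough. *)
Lemma spanner_line eps (H : {set {set V}}) : eps < 1 -> (m = 0%N \/ eps * A%:R <= 1) ->
  0 < eps -> spanner line_graph (1 + eps) H -> line_edges \subset H.
Proof.
move=> eps1 epsA eps0 [HE sp]; apply/fintype.subsetP => e eE.
apply: contraT => eH; have [u [v [uv nuv eq_e]]] := line_edges_pair eE.
have uvlt := line_edge_lt A_ge4 uv.
have avoid a b : adj H a b -> ~ (a = u /\ b = v) /\ ~ (a = v /\ b = u).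
  rewrite /adj => ab; split=> -[ab1 ab2]; subst a b; move: eH; rewrite eq_e ?ab //.
  by rewrite finset.setUC ab.
have sub a b : adj H a b -> line_adj A m N a b.
  by rewrite -adj_line; exact: (fintype.subsetP HE).
have wle : (d u v <= line_wt A u v)%N by apply: line_dist_edge.
have low k : (forall p, path (adj H) u p -> last u p = v -> (k <= wlen W u p)%N) ->
    k%:R <= (1 + eps) * (line_wt A u v)%:R.
  move=> /(dist_line_ge HE) h; have := le_trans h (sp u v).
  rewrite dist_graph_line -EFinM lee_fin => /le_trans; apply.
  by rewrite ler_wpM2l ?ler_nat //; lra.
case/orP: (uv) => [/eqP vE|/existsP[i /andP[ch /eqP vE]]].
  have := low (2 * A)%N (fun p => unit_detour A_ge4 sub avoid vE).
  have -> : line_wt A u v = A by rewrite /line_wt vE eqxx.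
  have : 0 < A%:R :> R by rewrite ltr0n; lia.
  rewrite natrM; nra.
have := low (A * (A * (2 * (A - 2)) ^ i))%N (fun p => chord_detour A_ge4 sub avoid ch vE).
have -> : line_wt A u v = ((2 * (A - 2)) ^ i * (A * (A - 2) + (u %/ (2 * A) ^ i) %% A))%N.
  by rewrite vE line_wt_chord.
case: epsA => [m0|epsA]; first by case: (i) => j; rewrite m0.
have A0 : (0 < A)%N by exact: leq_trans A_ge4.
have := ltn_pmod (u %/ (2 * A) ^ i) A0.
move: ((u %/ _) %% A)%N ((2 * (A - 2)) ^ i)%N (expE_gt0 A_ge4 i) => r E E0 rA.
(* The worst residue is [A - 1], and [(A + 1) * (A * A - A - 1)] still falls short of
   [A * A * A]. *)
have : ((A + 1) * (E * (A * (A - 2) + r)) < A * (A * (A * E)))%N.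
  apply: (@leq_ltn_trans ((A + 1) * (E * (A * (A - 2) + (A - 1))))).
    by rewrite !leq_mul2l leq_add2l; apply/orP; right; apply/orP; right; move: rA; clear; lia.
  have [b ->] : exists b, A = (b + 2)%N by exists (A - 2)%N; move: A_ge4; clear; lia.
  rewrite !addnK (_ : (b + 2 - 1 = b + 1)%N); last by clear; lia.
  have -> : ((b + 2) * ((b + 2) * ((b + 2) * E)) = (b + 2 + 1) * (E * ((b + 2) * b + (b + 1))) + E * (2 * b + 5))%N by ring.
  by rewrite -[X in (X < _)%N]addn0 ltn_add2l muln_gt0 E0; clear; lia.
move=> h1; set w := (E * (_ + r))%N in h1 *; set B := (A * (A * E))%N in h1 *.
move=> h2; exfalso.
have h3 : A%:R * B%:R <= A%:R * ((1 + eps) * w%:R) :> R by rewrite ler_wpM2l.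
have h4 : (A%:R + 1) * w%:R < A%:R * B%:R :> R by move: h1; rewrite -(ltr_nat R) !natrM natrD.
have w0 : 0 <= w%:R :> R by [].
nra.
Qed.

End LineWGraph.

(** * The oracle *)

Section LineOracle.
Variables (R : realType) (A m N n : nat).
Hypotheses (A_ge4 : (4 <= A)%N) (m_le : (4 * m <= A)%N) (N_le : (N <= n)%N).
Hypotheses (N_mul : ((2 * A) ^ m %| N)%N) (n_gt0 : (0 < n)%N).
Local Notation V := 'I_n.+1.
Local Notation W := (@line_W A n).
Local Notation d := (@line_dist A m N n).
Local Notation adjV := (@line_adj A m N n).
Local Notation G := (@line_graph R A m N n A_ge4).

Definition line_oracle (T : {set V}) (L : R) : {set {set V}} :=
  [set e | [exists u : V, exists v : V, exists x : V, exists y : V,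
    [&& e == [set u; v]%SET, adjV u v, x \in T, y \in T, L <= (d x y)%:R,
        (d x y)%:R < 2 * L & (d x u + W u v + d v y <= d x y)%N]]]%SET.

Lemma line_oracleP (T : {set V}) (L : R) e : reflect (exists u v x y : V,
  [/\ e = [set u; v]%SET, adjV u v, x \in T, y \in T &
    [/\ L <= (d x y)%:R, (d x y)%:R < 2 * L & (d x u + W u v + d v y <= d x y)%N]])
  (e \in line_oracle T L).
Proof.
rewrite inE; apply: (iffP existsP) => [[u /existsP[v /existsP[x /existsP[y]]]]|].
  by case/and5P=> /eqP-> uv xT yT /and3P[a b c]; exists u, v, x, y.
move=> [u [v [x [y [-> uv xT yT [a b c]]]]]]; exists u; apply/existsP; exists v.
apply/existsP; exists x; apply/existsP; exists y.
by rewrite eqxx uv xT yT a b c.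
Qed.

Lemma line_dist_adj (x y : V) : adjV x y -> (d x y <= W x y)%N.
Proof. exact: sdist_edge. Qed.

Lemma line_dist_min (x : V) p : path adjV x p -> (d x (last x p) <= wlen W x p)%N.
Proof. exact: sdist_min. Qed.

Lemma line_oracle_sub (T : {set V}) (L : R) : line_oracle T L \subset line_edges A m N n.
Proof.
apply/fintype.subsetP => e /line_oracleP[u [v [x [y [-> uv _ _ _]]]]].
by rewrite -(@adj_line A m N n A_ge4) in uv.
Qed.

Lemma line_oracle_dist (T : {set V}) (L : R) x y : x \in T -> y \in T ->
  L <= (d x y)%:R -> (d x y)%:R < 2 * L ->
  (dist G (line_oracle T L) x y <= (d x y)%:R%:E)%E.
Proof.
move=> xT yT xy1 xy2.
have [p [xp py pl]] := sdist_walk W (@line_connected A m N n) x y.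
rewrite -{1}py; apply: dist_line_le; rewrite ?pl //.
(* Induction along the walk: the distance from [x] to the current vertex plus the remaining length
   stays [d x y], so each edge passes the oracle's test. *)
suff h z : path adjV z p -> last z p = y -> (d x z + wlen W z p)%N = d x y ->
    path (adj (line_oracle T L)) z p by apply: h; rewrite ?line_distxx.
elim: p z {xp py pl} => // c p IH z /= /andP[zc cp] py h.
have h1 : (d x c <= d x z + W z c)%N.
  by have := @line_dist_tri A m N n z x c; have := line_dist_adj zc; lia.
have h2 : (d c y <= wlen W c p)%N by rewrite -py; exact: line_dist_min.
have h3 := @line_dist_tri A m N n c x y.
apply/andP; split; last by apply: IH => //; lia.
apply/line_oracleP; exists z, c, x, y; split=> //; split=> //; lia.
Qed.

(** Walking along unit edges only. It justifies [n.+1] times the weight of the edge [{0, 1}] as the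
    infinity of the program. *)
Lemma line_dist_ub (x y : V) : (d x y <= A * n.+1)%N.
Proof.
suff ub k (u v : V) : v = (u + k)%N :> nat -> (d u v <= A * k)%N.
  have [xy|yx] := leqP x y.
    apply: leq_trans (ub (y - x)%N _ _ _) _; first by rewrite subnKC.
    by rewrite leq_mul2l leq_subLR (leq_trans (ltnW (ltn_ord y))) ?leq_addl ?orbT.
  rewrite line_dist_sym; apply: leq_trans (ub (x - y)%N _ _ _) _; first by rewrite subnKC // ltnW.
  by rewrite leq_mul2l leq_subLR (leq_trans (ltnW (ltn_ord x))) ?leq_addl ?orbT.
elim: k v => [|k IH] v vE.
  by rewrite (_ : v = u) ?line_distxx //; apply: val_inj; rewrite /= vE addn0.
have wn : (u + k < n.+1)%N by rewrite (leq_ltn_trans _ (ltn_ord v)) // vE leq_add2l.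
have uv : line_edge A m N (Ordinal wn) v by rewrite /line_edge /= vE addnS eqxx.
have := @line_dist_tri A m N n (Ordinal wn) u v; have := IH (Ordinal wn) erefl.
have := line_dist_edge A_ge4 uv; rewrite /line_wt /= vE addnS eqxx.
rewrite mulnS; lia.
Qed.

Lemma nat_edge_ord (x y : V) : nat_edge n.+1 x y = [set x; y]%SET.
Proof. by rewrite /nat_edge !valK. Qed.

Lemma line_oracle_runs (t : R) (T : {set V}) (L : R) : exists2 k, (k <= 100 * n.+1 ^ 100)%N &
  runs oracle_prog G t T L k (line_oracle T L).
Proof.
pose s0 := input G t T L.
pose adjn i j := nat_edge n.+1 i j \in line_edges A m N n.
pose inT i := if insub i is Some u then (u : V) \in T else false.
pose delta i j : R := (d (inord i) (inord j))%:R.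
pose w i j := rmem s0 0 i j.
have adjE (x y : V) : adjn x y = adjV x y.
  by rewrite /adjn nat_edge_ord -(@adj_line A m N n A_ge4).
have wE (x y : V) : adjV x y -> w x y = (W x y)%:R.
  move=> xy; rewrite /w /= nat_edge_ord -[_ \in _]/(adj _ x y) (@adj_line A m N n A_ge4) xy.
  by rewrite set_wt_pair // (line_adj_neq A_ge4 xy).
have dE (x y : V) : delta x y = (d x y)%:R by rewrite /delta !inord_val.
have ord i : (i < n.+1)%N -> exists x : V, i = x by move=> h; exists (Ordinal h).
have v1 : (1 < n.+1)%N by [].
have e01 : line_edge A m N (ord0 : V) (Ordinal v1) by rewrite /line_edge eqxx.
have w01 : w 0%N 1%N = A%:R.
  rewrite -[0%N]/(val (ord0 : V)) -[1%N]/(val (Ordinal v1)) wE; last by rewrite /line_adj e01.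
  by rewrite line_W_lt //= /line_wt eqxx.
have inp : holds_input n.+1 w adjn inT L s0.
  by split=> // i; rewrite /inT /=; case: insub.
have h1 i j : (i < n.+1)%N -> (j < n.+1)%N -> delta i j <= n.+1%:R * w 0%N 1%N.
  by move=> _ _; rewrite w01 -natrM ler_nat mulnC line_dist_ub.
have h2 i : (i < n.+1)%N -> delta i i = 0 by move=> _; rewrite /delta line_distxx.
have h3 i k j : (i < n.+1)%N -> (k < n.+1)%N -> (j < n.+1)%N -> adjn i k ->
    delta i j <= w i k + delta k j.
  move=> /ord[x ->] /ord[z ->] /ord[y ->]; rewrite adjE => xz; rewrite wE // !dE -natrD ler_nat.
  by have := @line_dist_tri A m N n z x y; have := line_dist_adj xz; lia.
have h4 i j : (i < n.+1)%N -> (j < n.+1)%N -> exists p,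
    [/\ reaches n.+1 adjn i j p, (size p <= n.+1)%N & rlen w i p = delta i j].
  move=> /ord[x ->] /ord[y ->]; rewrite dE.
  have [p [xp py pl]] := sdist_walk W (@line_connected A m N n) x y.
  exists [seq val z | z <- p]; split.
  - split; last by rewrite last_map py.
      rewrite path_map; apply: sub_path xp => a b; by rewrite /= adjE.
    by apply/allP => _ /mapP[z _ ->]; exact: ltn_ord.
  - rewrite size_map -[n.+1 in X in (_ <= X)%N]card_ord ltnW //.
    have pl' : wlen W x p = sdist W (@line_connected A m N n) x (last x p) by rewrite py.
    exact: (shortest_walk_size (line_W_gt0 A_ge4) xp pl').
  rewrite -[d x y]pl; elim: p x xp {py pl} => //= z p IH x /andP[xz zp].
  by rewrite wE // IH // natrD.
have [k [s [ex kb out]]] := oracle_progP h1 h2 h3 h4 (ltn0Sn n) inp (fun _ _ => erefl) erefl.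
exists k => //; exists s => //; apply/setP => e; apply/line_oracleP/idP.
  move=> [u [v [x [y [-> uv xT yT [c1 c2 c3]]]]]]; rewrite inE; apply/existsP; exists u.
  apply/existsP; exists v; rewrite eqxx; apply/out => //; split=> //; first by rewrite adjE.
  exists x, y; split=> //; rewrite /inT !valK xT yT !dE c1 c2 wE //.
  by rewrite -!natrD ler_nat.
rewrite inE => /existsP[u /existsP[v /andP[/eqP-> /out]]].
case=> // _ _; rewrite adjE => uv [_ [_ [/ord[x ->] /ord[y ->]]]].
rewrite /inT !valK !dE wE // -!natrD ler_nat => /and5P[xT yT c1 c2 c3].
by exists u, v, x, y; split.
Qed.

Lemma line_oracle_spanner eps : 0 < eps ->
  sparse_spanner_oracle oracle_prog 100 G (1 + eps) line_oracle.
Proof.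
move=> eps0 T L L0; split; [exact: line_oracle_runs|exact: line_oracle_sub|].
move=> x y xT yT _; rewrite dist_graph_line !lee_fin lte_fin => h1 h2.
apply: le_trans (line_oracle_dist xT yT h1 h2) _.
by rewrite -EFinM lee_fin ler_peMl //; lra.
Qed.

(** Double counting: each edge of [F] is paid for by some list entry, and each entry denotes a
    single edge. *)
Lemma sum_charged (F : {set {set V}}) (T : {set V}) (g : {set V} -> nat)
    (l : nat -> seq (nat * nat)) (h : nat * nat -> nat) :
  (forall e, e \in F -> exists z c,
     [/\ z \in T, c \in l z, e = nat_edge n.+1 c.1 c.2 & g e = h c]) ->
  (\sum_(e in F) g e <= \sum_(z in T) \sum_(c <- l z) h c)%N.
Proof.
move=> ch; pose t e c := ((e == nat_edge n.+1 c.1 c.2) * h c)%N.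
apply: (@leq_trans (\sum_(e in F) \sum_(z in T) \sum_(c <- l z) t e c)).
  apply: leq_sum => e /ch[z [c [zT cl eE ge]]].
  rewrite (bigD1 z) //= (big_rem c) //= {1}/t eE eqxx mul1n -eE ge -addnA.
  exact: leq_addr.
rewrite exchange_big; apply: leq_sum => z _ /=; rewrite exchange_big.
apply: leq_sum => c _ /=; rewrite /t -big_distrl /=.
rewrite -[X in (_ <= X)%N]mul1n leq_mul2r; apply/orP; right.
rewrite big_mkcond /= (bigD1 (nat_edge n.+1 c.1 c.2)) //= big1 => [|e /negbTE->].
  by rewrite eqxx addn0; case: ifP.
by case: ifP.
Qed.

Lemma line_oracle_weight (T : {set V}) (L : R) : 0 < L ->
  weight G (line_oracle T L) <= #|T|%:R * (80 * L).
Proof.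
(* Distances are integers, so those below [2 * L] are at most [M], which becomes the range of the
   charges; hence 80 instead of 40. *)
move=> L0; pose M := Num.truncn (2 * L).
have L20 : 0 <= 2 * L by rewrite mulr_ge0 // ltW.
have M2 : M%:R <= 2 * L by rewrite truncn_le.
rewrite /weight -natr_sum.
have le : (\sum_(e in line_oracle T L) set_wt A e <=
    \sum_(z in T) \sum_(c <- charged_edges A m n M z) line_wt A c.1 c.2)%N.
  apply: sum_charged => _ /line_oracleP[u [v [x [y [-> uv xT yT [_ c2 c3]]]]]].
  have xyM : (d x y <= M)%N by rewrite truncn_ge_nat // ltW.
  have eq3 : (d x u + W u v + d v y)%N = d x y.
    have := @line_dist_tri A m N n v x y; have := @line_dist_tri A m N n u x v.
    by have := line_dist_adj uv; lia.
  have nuv := line_adj_neq A_ge4 uv.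
  rewrite set_wt_pair //; case/orP: uv => uv; have lt := line_edge_lt A_ge4 uv.
    rewrite line_W_lt // in eq3 *.
    have [h|h] := shortest_charged A_ge4 m_le N_le N_mul uv eq3 xyM;
      [exists x|exists y]; exists (val u, val v); split=> //; by rewrite nat_edge_ord.
  (* Here the edge is traversed from right to left, so the reversed walk from [y] to [x] is
     charged. *)
  rewrite line_W_sym line_W_lt // in eq3 *.
  have eq3' : (d y v + line_wt A v u + d u x)%N = d y x.
    by rewrite (@line_dist_sym A m N n y v) (@line_dist_sym A m N n u x) (@line_dist_sym A m N n y x) -eq3; lia.
  rewrite (@line_dist_sym A m N n) in xyM.
  have [h|h] := shortest_charged A_ge4 m_le N_le N_mul uv eq3' xyM;
    [exists y|exists x]; exists (val v, val u); split=> //=;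
    rewrite ?nat_edge_ord 1?finset.setUC //.
have le2 : (\sum_(z in T) \sum_(c <- charged_edges A m n M z) line_wt A c.1 c.2 <= #|T| * (40 * M))%N.
  rewrite -sum_nat_const; apply: leq_sum => z _; exact: (charge_wt_le m n A_ge4 M z).
apply: (@le_trans _ _ (#|T| * (40 * M))%:R); first by rewrite ler_nat (leq_trans le).
rewrite !natrM ler_wpM2l //; lra.
Qed.

Lemma line_oracle_sparse : (weak_sparsity G line_oracle <= 80%:E)%E.
Proof.
apply: ge_ereal_sup => _ [T [L [T0 L0 ->]]].
rewrite lee_fin ler_pdivrMr ?mulr_gt0 ?ltr0n //.
by apply: le_trans (line_oracle_weight T L0) _; rewrite mulrCA.
Qed.

End LineOracle.

(** * Lightness *)

Section Lightness.
Variables (R : realType) (A m N n : nat).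
Hypotheses (A_ge4 : (4 <= A)%N) (m_le : (4 * m <= A)%N) (N_le : (N <= n)%N).
Hypotheses (N_mul : ((2 * A) ^ m %| N)%N) (n_gt0 : (0 < n)%N) (n_le : (n <= 2 * N)%N).
Local Notation V := 'I_n.+1.
Local Notation K := (2 * A)%N.
Local Notation E := (2 * (A - 2))%N.
Local Notation G := (@line_graph R A m N n A_ge4).

Lemma sum_line_edges : (\sum_(e in line_edges A m N n) set_wt A e =
  \sum_(x : V) \sum_(y : V | line_edge A m N x y) line_wt A x y)%N.
Proof.
rewrite /line_edges big_imset /=; last exact: pair_edge_inj.
rewrite (pair_big_dep predT (fun x y : V => line_edge A m N x y)
  (fun x y : V => line_wt A x y)) /=.
apply: eq_big => [p|p]; rewrite inE // => h.
have lt := line_edge_lt A_ge4 h.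
by rewrite set_wt_pair ?line_W_lt // neq_ltn lt.
Qed.

(** Ranks 0 to [A - 1] are counted in each of the [N / K ^ i.+1] cells, and
    [K ^ i.+1 = A * (2 * K ^ i)]. *)
Lemma card_chord i : (i < m)%N ->
  (N <= #|[set x : V | chord A m N i x]%SET| * (2 * K ^ i))%N.
Proof.
move=> im; pose J := (N %/ K ^ i.+1)%N.
have NJ : N = (J * K ^ i.+1)%N.
  by apply/esym/divnK; apply: dvdn_trans N_mul; exact: dvdn_exp2l.
have X0 := expK_gt0 A_ge4 i.
have A0 : (0 < A)%N by exact: leq_trans A_ge4.
pose f (p : 'I_J * 'I_A) : V := inord ((p.1 * K + p.2) * K ^ i).
have fE p : f p = ((p.1 * K + p.2) * K ^ i)%N :> nat.
  rewrite inordK // ltnS (leq_trans _ N_le) // NJ expnS [(J * _)%N]mulnA leq_mul2r; apply/orP; right.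
  case: p => [[a aJ] [b bA]] /=; apply: (@leq_trans (a.+1 * K)); last by rewrite leq_mul2r aJ orbT.
  by rewrite mulSn addnC leq_add2r; move: bA; clear; lia.
have finj : injective f.
  move=> [a b] [a' b'] h; have := fE (a, b); rewrite h fE /= => /eqP.
  rewrite eqn_pmul2r // => /eqP h'.
  have lt (c : 'I_A) : (c < K)%N by apply: leq_trans (ltn_ord c) _; rewrite leq_pmull.
  have bb := radix_inj h' (lt _) (lt _); rewrite bb in h'.
  congr (_, _); apply: val_inj => //=; move/addIn/eqP: h'.
  by rewrite eqn_pmul2r ?muln_gt0 // => /eqP.
have sub : ([set f p | p in [set: 'I_J * 'I_A]] \subset [set x : V | chord A m N i x])%SET.
  apply/fintype.subsetP => _ /imsetP[p _ ->]; rewrite inE; apply/(chordP m N A_ge4).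
  exists p.1, p.2; split=> //; first exact: ltnW.
  by rewrite NJ expnS leq_mul2r ltn_ord orbT.
have := subset_leq_card sub; rewrite card_imset // cardsT card_prod !card_ord => le.
rewrite {1}NJ; apply: leq_trans (leq_mul le (leqnn _)).
by rewrite expnS -!mulnA leq_mul2l; apply/orP; right; rewrite !mulnA [(A * 2)%N]mulnC.
Qed.

(** At most one term on the left is nonzero, as the lengths 1 and [A * K ^ i] are pairwise
    distinct. *)
Lemma line_edge_wt_ge (x y : V) :
  ((y == x.+1 :> nat) * A +
     \sum_(i < m) (chord A m N i x && (y == x + A * K ^ i :> nat)) * (E ^ i * (A * (A - 2)))
   <= line_edge A m N x y * line_wt A x y)%N.
Proof.
have A0 : (0 < A)%N by exact: leq_trans A_ge4.
have [/existsP[i /andP[ch /eqP yE]]|none] :=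
    boolP [exists i : 'I_m, chord A m N i x && (y == x + A * K ^ i :> nat)%N].
  have -> : line_edge A m N x y by rewrite yE line_edge_chord.
  have big : (1 < A * K ^ i)%N.
    by apply: leq_trans (leq_pmulr _ (expK_gt0 A_ge4 i)); exact: leq_trans A_ge4.
  rewrite {1}yE -[x.+1]addn1 eqn_add2l gtn_eqF // mul0n add0n mul1n.
  rewrite (bigD1 i) //= ch yE eqxx mul1n big1 ?addn0 => [|j ji].
    by rewrite line_wt_chord // leq_mul2l leq_addr orbT.
  rewrite eqn_add2l eqn_pmul2l // eqn_exp2l; last by move: A_ge4; clear; lia.
  by rewrite [(_ == _ :> nat)](inj_eq val_inj) eq_sym (negbTE ji) andbF.
rewrite big1 => [|i _]; last first.
  rewrite (_ : _ && _ = false) //; apply/negbTE; apply: contra none => h; by apply/existsP; exists i.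
rewrite addn0; case: eqP => [yE|//].
by rewrite /line_edge /line_wt yE eqxx !mul1n.
Qed.

(** The 4 is a product of two factors 2: level [i] has at least [N / (2 * K ^ i)] chords, and
    [K ^ i <= 2 * E ^ i]. *)
Lemma line_graph_weight :
  (4 * (A * n) + m * (N * (A * (A - 2))) <= 4 * \sum_(e in line_edges A m N n) set_wt A e)%N.
Proof.
have A0 : (0 < A)%N by exact: leq_trans A_ge4.
rewrite sum_line_edges.
apply: (@leq_trans (4 * \sum_(x : V) \sum_(y : V) ((y == x.+1 :> nat) * A +
     \sum_(i < m) (chord A m N i x && (y == x + A * K ^ i :> nat)) * (E ^ i * (A * (A - 2)))))); last first.
  rewrite leq_mul2l; apply/orP; right; apply: leq_sum => x _.
  rewrite [X in (_ <= X)%N]big_mkcond /=; apply: leq_sum => y _.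
  by apply: leq_trans (line_edge_wt_ge x y) _; case: ifP; rewrite ?mul1n.
under eq_bigr => x _ do rewrite big_split /=.
rewrite big_split /= mulnDr; apply: leq_add.
  rewrite leq_mul2l; apply/orP; right; rewrite big_ord_recr /=.
  apply: leq_trans (leq_addr _ _); rewrite mulnC -[n in X in (X <= _)%N]card_ord -sum_nat_const.
  apply: leq_sum => i _; rewrite (bigD1 (inord i.+1)) //= inordK ?ltnS //.
  by rewrite eqxx mul1n leq_addr.
under eq_bigr => x _ do rewrite exchange_big /=.
rewrite exchange_big /= -[m in X in (X <= _)%N]card_ord -sum_nat_const big_distrr /=.
apply: leq_sum => i _.
apply: (@leq_trans (4 * (#|[set x : V | chord A m N i x]%SET| * (E ^ i * (A * (A - 2))))))%N.
  have h1 := card_chord (ltn_ord i); have h2 := expK_le2E A_ge4 m_le (ltnW (ltn_ord i)).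
  apply: (@leq_trans (#|[set x : V | chord A m N i x]%SET| * (2 * K ^ i) * (A * (A - 2)))).
    by rewrite leq_mul2r h1 orbT.
  move: #|_| => c; have -> : (4 * (c * (E ^ i * (A * (A - 2)))) =
    c * (2 * (2 * E ^ i)) * (A * (A - 2)))%N by ring.
  by rewrite leq_mul2r !leq_mul2l h2 !orbT.
rewrite leq_mul2l /= -sum1_card big_distrl /= big_mkcond /=; apply: leq_sum => x _.
rewrite inE; case: ifP => // ch; rewrite mul1n.
have xn : (x + A * K ^ i < n.+1)%N.
  have [j [c [_ -> cA jN]]] := chordP m N A_ge4 _ _ ch.
  rewrite ltnS (leq_trans _ N_le) // (leq_trans _ jN) // -mulnDl [(j.+1 * _)%N]mulnA leq_mul2r.
  apply/orP; right; move: cA; clear; lia.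
by rewrite (bigD1 (Ordinal xn)) //= eqxx mul1n leq_addr.
Qed.

(** * The unit path as a spanning tree *)

Definition path_pairs : {set V * V} := [set p : V * V | p.2 == p.1.+1 :> nat]%SET.
Definition path_edges : {set {set V}} := [set pair_edge p | p in path_pairs]%SET.

Lemma path_pairs_sub : path_pairs \subset line_pairs A m N n.
Proof. by apply/fintype.subsetP => p; rewrite !inE /line_edge => ->. Qed.

Lemma adj_path (x y : V) : adj path_edges x y = (y == x.+1 :> nat) || (x == y.+1 :> nat).
Proof.
rewrite /adj; apply/imsetP/idP => [[[a b]]|].
  rewrite inE /= => /eqP ab /setP e.
  have := e a; have := e b; have := e x; have := e y; rewrite !inE !eqxx ?orbT /=.
  move=> /esym/orP[]/eqP ? /esym/orP[]/eqP ? /orP[]/eqP ? /orP[]/eqP ?; subst => //;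
    move: ab; clear; lia.
case/orP=> h; [exists (x, y)|exists (y, x)]; rewrite ?inE //.
by rewrite /pair_edge /= finset.setUC.
Qed.

(** The largest vertex of a cycle would have two distinct neighbours in it, both equal to its
    predecessor on the line. *)
Lemma path_acyclic : acyclic_graph path_edges.
Proof.
move=> c c2 uc.
have [z zc zmax] : exists2 z : V, z \in c & forall x, x \in c -> (x <= z)%N.
  have [x0 x0c] : exists x0, x0 \in c by case: (c) c2 => // a ? _; exists a; rewrite mem_head.
  case: (@arg_maxnP _ x0 (mem c) (fun x : V => x : nat) x0c) => z zc zm.
  by exists z.
have [k s sE] := rot_to zc; move: uc c2; rewrite -(rot_ucycle k) -(size_rot k) sE.
have smax x : x \in s -> (x <= z)%N.
  by move=> xs; apply: zmax; rewrite -(mem_rot k) sE inE xs orbT.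
case: s smax {sE} => // a s smax; rewrite /ucycle /= => /andP[] /andP[za].
rewrite rcons_path => /andP[_ lz] /andP[_ /andP[as_ _]]; case: s => // b s in smax lz as_ *.
move: za lz; rewrite !adj_path /= => za lz _.
have la := smax a (mem_head _ _).
have ll := smax (last b s) (ltac:(by rewrite inE mem_last orbT)).
have : last b s = a.
  apply: val_inj => /=; move: (last b s) lz ll => l lz ll.
  move: za lz la ll; move: (nat_of_ord a) (nat_of_ord l) (nat_of_ord z) => p q r.
  by clear; lia.
by move=> h; rewrite -h mem_last in as_.
Qed.

Lemma path_spanning : spanning_tree G path_edges.
Proof.
split; [exact: imsetS path_pairs_sub| |exact: path_acyclic].
have sym : symmetric (adj path_edges) by move=> a b; rewrite !adj_path orbC.
suff h k (z : V) : z = k :> nat -> connect (adj path_edges) ord0 z.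
  by move=> x y; apply: connect_trans (h _ y erefl); rewrite (sym_connect_sym sym); apply: h.
elim: k z => [|k IH] z zk; first by rewrite (_ : z = ord0) //; apply: val_inj.
have kn : (k < n.+1)%N by rewrite -ltnS -zk ltnW // ltnS.
apply: connect_trans (IH (Ordinal kn) erefl) _; apply: connect1.
by rewrite adj_path /= zk eqxx.
Qed.

Lemma path_weight : weight G path_edges <= (A * n)%:R.
Proof.
rewrite /weight -natr_sum ler_nat /path_edges big_imset /=; last first.
  have sub := fintype.subsetP path_pairs_sub.
  by move=> p q /sub pp /sub qp; exact: (pair_edge_inj A_ge4 N_le pp qp).
rewrite (eq_bigr (fun=> A)) => [|p]; last first.
  rewrite inE => /eqP h; have lt : (p.1 < p.2)%N by rewrite h.
  by rewrite set_wt_pair ?line_W_lt ?neq_ltn ?lt // /line_wt h eqxx.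
rewrite sum_nat_const mulnC leq_mul2l; apply/orP; right.
pose f (i : 'I_n) : V * V := (inord i, inord i.+1).
have sub : path_pairs \subset [set f i | i in [set: 'I_n]]%SET.
  apply/fintype.subsetP => -[a b]; rewrite inE /= => /eqP ba.
  have an : (a < n)%N by rewrite -ltnS -ba.
  apply/imsetP; exists (Ordinal an); first by rewrite inE.
  rewrite /f /=; by rewrite -ba !inord_val.
by have := subset_leq_card sub; move/leq_trans; apply; rewrite (leq_trans (leq_imset_card _ _)) // cardsT card_ord.
Qed.

(** A crude bound from integrality; it bounds the infimum defining [mst_weight] away from 0. *)
Lemma tree_weight F : spanning_tree G F -> 1 <= weight G F.
Proof.
move=> [FE Fc _]; have v1 : (1 < n.+1)%N by [].
have /connectP[p] := Fc ord0 (Ordinal v1).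
case: p => [_ /(congr1 val)//|x p /= /andP[x0 _] _].
rewrite /weight (bigD1 [set ord0; x]%SET) //=.
have h1 : 1 <= (set_wt A [set ord0; x]%SET)%:R :> R.
  by have := line_edges_wt_gt0 R A_ge4 (fintype.subsetP FE _ x0); rewrite ltr0n ler1n.
apply: le_trans h1 _; rewrite lerDl; apply: sumr_ge0 => e _; exact: ler0n.
Qed.

Lemma mst_gt0 : 0 < mst_weight G.
Proof.
apply: (@lt_le_trans _ _ 1) => //; apply: lb_le_inf.
  by exists (weight G path_edges), path_edges; first exact: path_spanning.
by move=> _ [F sF ->]; exact: tree_weight.
Qed.

Lemma mst_le : mst_weight G <= (A * n)%:R.
Proof.
apply: le_trans path_weight; apply: ge_inf.
  by exists 1 => _ [F sF ->]; exact: tree_weight.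
by exists path_edges; first exact: path_spanning.
Qed.

(** Dividing by [A * n], with [n <= 2 * N] turning the 4 of [line_graph_weight] into 8. The additive
    8 stems from the unit edges and covers [m = 0]. *)
Lemma lightness_ge (H : {set {set V}}) : line_edges A m N n \subset H ->
  H \subset line_edges A m N n -> 8 + (m * (A - 2))%:R <= 8 * lightness G H.
Proof.
move=> h1 h2; have -> : H = line_edges A m N n by apply/eqP; rewrite finset.eqEsubset h1 h2.
rewrite /lightness mulrA ler_pdivlMr ?mst_gt0 //.
apply: le_trans (ler_wpM2l _ mst_le) _; first by rewrite addr_ge0.
rewrite /weight -natr_sum -natrD -!natrM ler_nat.
have := line_graph_weight; move: (\sum_(e in _) _)%N => S h.
have le : (m * (n * (A * (A - 2))) <= 2 * (m * (N * (A * (A - 2)))))%N.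
  rewrite [(2 * (m * _))%N]mulnCA leq_mul2l [(2 * (N * _))%N]mulnA leq_mul2r.
  by rewrite n_le !orbT.
have -> : ((8 + m * (A - 2)) * (A * n) = 8 * (A * n) + m * (n * (A * (A - 2))))%N by ring.
lia.
Qed.

End Lightness.

(** * Choice of the parameters *)

Lemma line_parameters (R : realType) (eps : R) (n : nat) :
  0 < eps -> eps < 1 -> (1 / eps) `^ (1 / eps) <= n%:R ->
  exists A m : nat, [/\ (4 <= A)%N, (4 * m <= A)%N, m = 0%N \/ eps * A%:R <= 1,
    ((2 * A) ^ m < n)%N & 8 * (1 / 2000 / eps ^+ 2) <= 8 + (m * (A - 2))%:R].
Proof.
move=> eps0 eps1; rewrite !div1r; set x := eps^-1 => xn.
have x1 : 1 < x by rewrite invf_gt1.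
have xE : eps * x = 1 by rewrite mulfV // gt_eqF.
have pow_le k : k%:R <= x -> x ^+ k <= n%:R.
  move=> kx; apply: le_trans xn; rewrite -powR_mulrn; last lra.
  by rewrite ler_powR // ltW.
have -> : 2000^-1 / eps ^+ 2 = 2000^-1 * x ^+ 2 by rewrite exprVn.
(* For [1 / eps < 10] no chords are used: [x ^ 2 / 2000] is then below 1, which the unit path alone
   provides. *)
have [x10|x10] := ltP x 10.
  exists 10%N, 0%N; split=> //; first by left.
    by have := pow_le 1%N (ltW x1); rewrite expn0 expr1 => /(lt_le_trans x1); rewrite ltr1n.
  rewrite mul0n addr0; nra.
pose A := Num.truncn x.
have x0 : 0 <= x by lra.
have /andP[Ax xA] : A%:R <= x < A.+1%:R by exact: truncn_itv.
have A10 : (10 <= A)%N by rewrite truncn_ge_nat.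
(* The divisor 10 ensures [2 * m + 1 <= x], while [A <= 20 * m] keeps the number of levels of order
   [1 / eps]. *)
pose m := (A %/ 10)%N; exists A, m.
have m10 : (10 * m <= A)%N by rewrite mulnC leq_divM.
have m20 : (A <= 20 * m)%N.
  have : (1 <= m)%N by rewrite leq_divRL.
  by have := ltn_ceil A (isT : 0 < 10)%N; rewrite -/m mulSn; lia.
have m10R : 10 * m%:R <= A%:R :> R by rewrite -natrM ler_nat.
have m20R : A%:R <= 20 * m%:R :> R by rewrite -natrM ler_nat.
have A10R : 10 <= A%:R :> R by rewrite ler_nat.
split.
- exact: leq_trans A10.
- by apply: leq_trans m10; rewrite leq_mul2r orbT.
- by right; rewrite -[leRHS]xE ler_wpM2l // ltW.
(* The chain is [(2 * A) ^ m <= (x ^ 2) ^ m < x ^ (2 * m + 1) <= n]. *)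
- have k : (2 * m + 1)%:R <= x by rewrite natrD natrM; lra.
  rewrite -(ltr_nat R); apply: lt_le_trans (pow_le _ k).
  rewrite natrX natrM exprD expr1 exprM.
  apply: (@le_lt_trans _ _ ((x ^+ 2) ^+ m)).
    by rewrite lerXn2r ?nnegrE ?mulr_ge0 ?exprn_ge0 //; nra.
  by rewrite ltr_pMr // exprn_gt0 // exprn_gt0 //; lra.
have -> : (m * (A - 2))%:R = m%:R * (A%:R - 2) :> R by rewrite natrM natrB // (leq_trans _ A10).
have xA' : x <= 2 * A%:R by rewrite -natr1 in xA; lra.
have h1 : x ^+ 2 <= (2 * A%:R) ^+ 2 by rewrite lerXn2r ?nnegrE ?mulr_ge0.
have h2 : A%:R * (A%:R - 2) <= 20 * m%:R * (A%:R - 2) :> R by rewrite ler_wpM2r //; lra.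
nra.
Qed.

Theorem theorem1p14 (R : realType) :
  exists (A : cmd) (k : nat) (C s c : R),
    [/\ 0 < C, 0 < s, 0 < c &
      forall (eps : R) (n : nat), 0 < eps -> eps < 1 ->
        (1 / eps) `^ (C / eps) <= n%:R ->
        exists G : wgraph R n,
          [/\ connected_graph (edges G),
              exists O : {set 'I_n} -> R -> {set {set 'I_n}},
                sparse_spanner_oracle A k G (1 + eps) O /\
                (weak_sparsity G O <= s%:E)%E
            & forall H : {set {set 'I_n}}, spanner G (1 + eps) H ->
                c / eps ^+ 2 <= lightness G H]].
Proof.
exists oracle_prog, 100%N, 1, 80, (1 / 2000).
split; [exact: ltr01|by rewrite ltr0n|by rewrite divr_gt0 ?ltr0n|].
move=> eps n eps0 eps1 /(line_parameters eps0 eps1)[A [m [A4 m4 epsA Kn lam]]].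
(* The [n + 1] vertices span [n] steps, so the strict bound leaves room for a complete cell of level
   [m]. *)
case: n Kn => // n; rewrite ltnS => Kn.
have K0 := expK_gt0 A4 m; have n0 : (0 < n)%N by exact: leq_trans Kn.
(* Chords fill only the complete cells of level [m], which cover at least half of the line. *)
pose N := (n %/ (2 * A) ^ m * (2 * A) ^ m)%N.
have Nn : (N <= n)%N by exact: leq_divM.
have NK : ((2 * A) ^ m %| N)%N by exact: dvdn_mull.
have nN : (n <= 2 * N)%N.
  have h1 : (1 <= n %/ (2 * A) ^ m)%N by rewrite leq_divRL ?mul1n.
  have := leq_mul h1 (leqnn ((2 * A) ^ m)); have := ltn_ceil n K0.
  rewrite mul1n mulSn -/N => /ltnW h2 h3; apply: leq_trans h2 _.
  by rewrite [(2 * N)%N]mul2n -addnn leq_add2r.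
exists (line_graph R m N n A4); split.
- exact: line_graph_connected.
- exists (@line_oracle R A m N n); split; first exact: line_oracle_spanner.
  exact: line_oracle_sparse.
move=> H sp; have HE := spanner_line Nn eps1 epsA eps0 sp.
have [HG _] := sp; have := lightness_ge R A4 m4 Nn NK n0 nN HE HG; lra.
Qed.
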